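(* Let $G$ be either the free product $G_1\ast\dots\ast G_n$, the direct product $G_1\times\dots\times G_n$, a semidirect product $G_1\rtimes G_2$, or a finite index subgroup of the group $G_1$. Suppose that each $G_i$, for $1\le i\le n$ (respectively, each of the groups $G_i$ occurring), is one of the following infinite finitely generated groups: a free group; a free abelian group; a Fuchsian group of genus $g\ge 2$; an infinite right angled Coxeter group; an Artin group; a pure braid group; a Baumslag-Solitar group; or an infinite virtually cyclic group. Then the nerve complex $\mathcal{NC}(G,\mathscr H_{\mathrm{fi}})$ and the order complex $\Delta P_{\mathrm{fi}}(G)$ are contractible.
   Context: For a group $G$: $\mathscr H_{\mathrm{fi}}$ is the set of all proper finite index subgroups of $G$, and $P_{\mathrm{fi}}(G)=\{Hg\mid H<G \text{ proper},\ [G:H]<\infty,\ g\in G\}$ is the set of all right cosets of such subgroups, partially ordered by inclusion. The order complex $\Delta P$ of a poset $P$ is the simplicial complex whose $n$-simplices are the chains $C_0\subset C_1\subset\dots\subset C_n$ in $P$. The nerve complex $\mathcal{NC}(G,\mathscr H)$ of $G$ with respect to a set $\mathscr H$ of subgroups is the simplicial complex with an $n$-simplex for every set $\{H_0g_0,\dots,H_ng_n\}$ of $n+1$ cosets with $H_i\in\mathscr H$, $g_i\in G$ and $H_0g_0\cap\dots\cap H_ng_n\ne\emptyset$. $G_1\rtimes G_2$ is a semidirect product with normal subgroup $G_1$, for any homomorphism $G_2\to\mathrm{Aut}(G_1)$. A Fuchsian group of genus $g\ge2$ is either orientation-preserving, with generators $a_1,b_1,\dots,a_g,b_g,x_1,\dots,x_d,y_1,\dots,y_s,z_1,\dots,z_t$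 and relators $x_1^{m_1},\dots,x_d^{m_d}$, $x_1\cdots x_dy_1\cdots y_sz_1\cdots z_t[a_1,b_1]\cdots[a_g,b_g]$; or non-orientation-preserving, with generators $a_1,\dots,a_g,x_1,\dots,x_d,y_1,\dots,y_s,z_1,\dots,z_t$ and relators $x_1^{m_1},\dots,x_d^{m_d}$, $x_1\cdots x_dy_1\cdots y_sz_1\cdots z_ta_1^2\cdots a_g^2$; here $d,s,t\ge0$, $m_i\ge2$. A right angled Coxeter group is $\langle s_1,\dots,s_n\mid s_i^2,(s_is_j)^{m_{i,j}}\rangle$ with all $m_{i,j}\in\{2,\infty\}$ for $i\neq j$ (no relation for $\infty$). It is infinite when some $m_{i,j}=\infty$. An Artin group is $\langle x_1,\dots,x_n\mid \langle x_i,x_j\rangle^{m_{i,j}}=\langle x_j,x_i\rangle^{m_{i,j}},\ i<j\rangle$, where $\langle x_i,x_j\rangle^{s}$ is the alternating product of $x_i$ and $x_j$ of length $s$ starting with $x_i$, and $m_{i,j}=m_{j,i}$ are integers $\geq 2$ or $\infty$ (no relation for $\infty$). Pure braid groups $PB_m$ are the usual ones. A Baumslag-Solitar group is $BS(m,n)=\langle a,b\mid ab^na^{-1}b^{-m}\rangle$ with $m,n$ integers. An infinite virtually cyclic group is a group containing an infinite cyclic subgroup of finite index. *)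

(* Defs.v *)
From HB Require Import structures.
From mathcomp Require Import all_boot all_order all_algebra.
From mathcomp Require Import fingroup perm generic_quotient finmap.
From mathcomp Require Import all_classical all_reals all_analysis.

Set Implicit Arguments.
Unset Strict Implicit.
Unset Printing Implicit Defensive.

Import Order.TTheory GRing.Theory Num.Theory.
Import numFieldNormedType.Exports.

Local Open Scope classical_set_scope.
Local Open Scope ring_scope.
Local Open Scope quotient_scope.

Section Subgroups.
Context {G : groupType}.
Implicit Types (H : set G) (g x : G).

Definition is_subgroup H : Prop :=
  H 1%g /\ (forall x y, H x -> H y -> H (x * y^-1)%g).

Definition right_coset H g : set G := [set (h * g)%g | h in H].

Definition finite_index H : Prop :=
  finite_set [set right_coset H g | g in [set: G]].

Definition cyclic_subgroup x : set G :=
  [set y | exists k : nat, y = (x ^+ k)%g \/ y = (x ^- k)%g].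

End Subgroups.

Definition finitely_generated (G : groupType) : Prop :=
  exists S : set G, finite_set S /\
    forall H : set G, is_subgroup H -> S `<=` H -> H = setT.

Definition isomorphic (G H : groupType) : Prop :=
  exists f : {multiplicative G -> H}, bijective f.

Section Words.
Variable I : choiceType.

(* The letter (i, true) is the generator x_i and (i, false) is its inverse. *)
Definition word := seq (I * bool).

Definition linv (l : I * bool) : I * bool := (l.1, ~~ l.2).
Definition winv (w : word) : word := rev (map linv w).
Definition wgen (i : I) : word := [:: (i, true)].
Definition wpow (w : word) (n : nat) : word := flatten (nseq n w).
Definition wpowz (w : word) (z : int) : word :=
  match z with Posz n => wpow w n | Negz n => wpow (winv w) n.+1 end.
Definition wcomm (u v : word) : word := u ++ v ++ winv u ++ winv v.

(* The congruence on words whose quotient is the free group on I modulo the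
   normal closure of R. *)
Inductive word_cong (R : set word) : word -> word -> Prop :=
| WCrefl w : word_cong R w w
| WCsym u v : word_cong R u v -> word_cong R v u
| WCtrans u v w : word_cong R u v -> word_cong R v w -> word_cong R u w
| WCcancel u v l : word_cong R (u ++ [:: l; linv l] ++ v) (u ++ v)
| WCrel u v r : R r -> word_cong R (u ++ r ++ v) (u ++ v).

Variable R : set word.

Definition word_rel : rel word := fun u v => `[< word_cong R u v >].

Lemma word_rel_refl : reflexive word_rel.
Proof. by move=> w; apply/asboolP; exact: WCrefl. Qed.

Lemma word_rel_sym : symmetric word_rel.
Proof. by move=> u v; apply/idP/idP => /asboolP/WCsym/asboolP. Qed.

Lemma word_rel_trans : transitive word_rel.
Proof.
by move=> v u w /asboolP uv /asboolP vw; apply/asboolP/(WCtrans uv vw).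
Qed.

Canonical word_equiv :=
  EquivRel word_rel word_rel_refl word_rel_sym word_rel_trans.

Definition presented : Type := {eq_quot word_equiv}.
HB.instance Definition _ := Choice.on presented.
HB.instance Definition _ := EqQuotient.on presented.

Definition pclass (w : word) : presented := \pi_presented w.

Lemma pclassP u v : pclass u = pclass v <-> word_cong R u v.
Proof.
rewrite /pclass; split; first by move/eqmodP/asboolP.
by move=> uv; apply/eqmodP/asboolP.
Qed.

Lemma pclassK (x : presented) : pclass (repr x) = x.
Proof. exact: reprK. Qed.

Lemma word_cong_cat u u' v v' :
  word_cong R u u' -> word_cong R v v' -> word_cong R (u ++ v) (u' ++ v').
Proof.
have catl w a b : word_cong R a b -> word_cong R (w ++ a) (w ++ b).
  elim=> [?|? ? _ /WCsym //|? ? ? _ h _|? ? ?|? ? ? ?].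
  - exact: WCrefl.
  - exact: WCtrans.
  - by rewrite !(catA w); exact: WCcancel.
  - by rewrite !(catA w); exact: WCrel.
have catr w a b : word_cong R a b -> word_cong R (a ++ w) (b ++ w).
  elim=> [?|? ? _ /WCsym //|? ? ? _ h _|? ? ?|? ? ? ?].
  - exact: WCrefl.
  - exact: WCtrans.
  - by rewrite -!catA; exact: WCcancel.
  - by rewrite -!catA; exact: WCrel.
by move=> uu' vv'; apply: WCtrans (catr _ _ _ uu') (catl _ _ _ vv').
Qed.

Lemma linvK : involutive linv.
Proof. by case=> i b; rewrite /linv /= negbK. Qed.

Lemma winvK : involutive winv.
Proof. by move=> w; rewrite /winv map_rev revK mapK //; exact: linvK. Qed.

Lemma word_cong_catV w : word_cong R (w ++ winv w) [::].
Proof.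
elim/last_ind: w => [|w l ih]; first exact: WCrefl.
rewrite /winv map_rcons rev_rcons cat_rcons -[_ :: _ :: _]/([:: l; linv l] ++ _).
exact: WCtrans (WCcancel _ _ _ _) ih.
Qed.

Lemma word_cong_winv u v : word_cong R u v -> word_cong R (winv u) (winv v).
Proof.
move=> uv; apply: WCsym.
have h1 : word_cong R (winv u ++ (v ++ winv v)) (winv u).
  rewrite -[X in word_cong _ _ X]cats0.
  by apply: word_cong_cat; [exact: WCrefl|exact: word_cong_catV].
apply: WCsym; apply: (WCtrans (WCsym h1)); rewrite catA -[X in word_cong _ _ X]cat0s.
apply: word_cong_cat; last exact: WCrefl.
apply: (WCtrans (v := winv u ++ u)).
  by apply: word_cong_cat; [exact: WCrefl|exact: WCsym].
by rewrite -{2}(winvK u); exact: word_cong_catV.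
Qed.

Definition pone : presented := pclass [::].
Definition pmul (x y : presented) : presented := pclass (repr x ++ repr y).
Definition pinv (x : presented) : presented := pclass (winv (repr x)).

Lemma pmulE u v : pmul (pclass u) (pclass v) = pclass (u ++ v).
Proof.
by apply/pclassP/word_cong_cat; apply/pclassP; rewrite pclassK.
Qed.

Lemma pinvE u : pinv (pclass u) = pclass (winv u).
Proof. by apply/pclassP/word_cong_winv/pclassP; rewrite pclassK. Qed.

Lemma pmulA : associative pmul.
Proof.
move=> x y z; rewrite -(pclassK x) -(pclassK y) -(pclassK z).
by rewrite !pmulE catA.
Qed.

Lemma pmul1 : left_id pone pmul.
Proof. by move=> x; rewrite -(pclassK x) pmulE. Qed.

Lemma pmulr1 : right_id pone pmul.
Proof. by move=> x; rewrite -(pclassK x) pmulE cats0. Qed.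

Lemma pmulV : right_inverse pone pinv pmul.
Proof.
move=> x; rewrite -(pclassK x) pinvE pmulE.
by apply/pclassP; exact: word_cong_catV.
Qed.

Lemma pmulVl : left_inverse pone pinv pmul.
Proof.
move=> x; rewrite -(pclassK x) pinvE pmulE -{2}(winvK (repr x)).
by apply/pclassP; exact: word_cong_catV.
Qed.

HB.instance Definition _ :=
  isGroup.Build presented pmulA pmul1 pmulr1 pmulVl pmulV.

Definition pgroup : groupType := presented.
Definition pgen (i : I) : pgroup := pclass (wgen i).

End Words.

Definition free_group (I : choiceType) : groupType := @pgroup I set0.

Definition free_abelian_group (I : choiceType) : groupType :=
  @pgroup I [set r | exists i j : I, r = wcomm (wgen i) (wgen j)].

Section Fuchsian.
Variables (g d s t : nat) (m : 'I_d -> nat).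

Definition fuchsian_preserving : groupType :=
  let I : choiceType := ('I_g + 'I_g + 'I_d + 'I_s + 'I_t)%type in
  let a i : word I := wgen (inl (inl (inl (inl i)))) in
  let b i : word I := wgen (inl (inl (inl (inr i)))) in
  let x i : word I := wgen (inl (inl (inr i))) in
  let y i : word I := wgen (inl (inr i)) in
  let z i : word I := wgen (inr i) in
  pgroup ([set wpow (x i) (m i) | i in [set: 'I_d]] `|`
          [set flatten [seq x i | i <- enum 'I_d]
               ++ flatten [seq y i | i <- enum 'I_s]
               ++ flatten [seq z i | i <- enum 'I_t]
               ++ flatten [seq wcomm (a i) (b i) | i <- enum 'I_g]]).

Definition fuchsian_nonpreserving : groupType :=
  let I : choiceType := ('I_g + 'I_d + 'I_s + 'I_t)%type in
  let a i : word I := wgen (inl (inl (inl i))) in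
  let x i : word I := wgen (inl (inl (inr i))) in
  let y i : word I := wgen (inl (inr i)) in
  let z i : word I := wgen (inr i) in
  pgroup ([set wpow (x i) (m i) | i in [set: 'I_d]] `|`
          [set flatten [seq x i | i <- enum 'I_d]
               ++ flatten [seq y i | i <- enum 'I_s]
               ++ flatten [seq z i | i <- enum 'I_t]
               ++ flatten [seq wpow (a i) 2 | i <- enum 'I_g]]).

End Fuchsian.

(* In the exponents m i j of Coxeter and Artin groups, None stands for oo. *)

Definition coxeter_group n (m : 'I_n -> 'I_n -> option nat) : groupType :=
  pgroup ([set wpow (wgen i) 2 | i in [set: 'I_n]] `|`
          [set r | exists (i j : 'I_n) k, [/\ i != j, m i j = Some k &
                                     r = wpow (wgen i ++ wgen j) k]]).

Definition right_angled n (m : 'I_n -> 'I_n -> option nat) : Prop :=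
  forall i j, i != j -> m i j = m j i /\ (m i j = Some 2%N \/ m i j = None).

Definition walt (I : choiceType) (i j : I) (k : nat) : word I :=
  mkseq (fun l => (if odd l then j else i, true)) k.

Definition artin_group n (m : 'I_n -> 'I_n -> option nat) : groupType :=
  pgroup [set r | exists (i j : 'I_n) k, [/\ (i < j)%N, m i j = Some k &
                                    r = walt i j k ++ winv (walt j i k)]].

Definition artin_exponents n (m : 'I_n -> 'I_n -> option nat) : Prop :=
  forall i j, i != j ->
    m i j = m j i /\ (forall k, m i j = Some k -> (2 <= k)%N).

(* The braid group on n.+1 strands, as the Artin group of type A_n. *)
Definition braid_exponent n (i j : 'I_n) : option nat :=
  Some (if (i.+1 == j) || (j.+1 == i) then 3%N else 2%N).

Definition braid_group (n : nat) : groupType := artin_group (@braid_exponent n).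

(* G is isomorphic to the kernel of the morphism from the braid group on n.+1
   strands to 'S_n.+1 sending the i-th generator to the transposition (i i+1). *)
Definition is_pure_braid_group (n : nat) (G : groupType) : Prop :=
  exists (p : {multiplicative braid_group n -> {perm 'I_n.+1}})
         (f : {multiplicative G -> braid_group n}),
    [/\ forall i : 'I_n,
          p (pgen _ i) = tperm (inord i : 'I_n.+1) (inord i.+1 : 'I_n.+1),
        injective f &
        range f = [set b | p b = 1%g]].

Definition baumslag_solitar (m n : int) : groupType :=
  let a : word bool := wgen true in
  let b : word bool := wgen false in
  pgroup [set a ++ wpowz b n ++ winv a ++ wpowz b (- m)].

Definition infinite_virtually_cyclic (G : groupType) : Prop :=
  exists x : G,
    infinite_set (cyclic_subgroup x) /\ finite_index (cyclic_subgroup x).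

Inductive listed_family (G : groupType) : Prop :=
| Free (I : choiceType) of isomorphic G (free_group I)
| FreeAbelian (I : choiceType) of isomorphic G (free_abelian_group I)
| FuchsianPreserving g d s t (m : 'I_d -> nat) of
    (2 <= g)%N & (forall i, (2 <= m i)%N) &
    isomorphic G (fuchsian_preserving g s t m)
| FuchsianNonpreserving g d s t (m : 'I_d -> nat) of
    (2 <= g)%N & (forall i, (2 <= m i)%N) &
    isomorphic G (fuchsian_nonpreserving g s t m)
| RightAngledCoxeter n (m : 'I_n -> 'I_n -> option nat) of
    right_angled m & isomorphic G (coxeter_group m)
| Artin n (m : 'I_n -> 'I_n -> option nat) of
    artin_exponents m & isomorphic G (artin_group m)
| PureBraid n of is_pure_braid_group n G
| BaumslagSolitar m n of isomorphic G (baumslag_solitar m n)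
| InfiniteVirtuallyCyclic of infinite_virtually_cyclic G.

Definition listed_group (G : groupType) : Prop :=
  [/\ infinite_set [set: G], finitely_generated G & listed_family G].

Definition free_product n (Gs : 'I_n -> groupType) : groupType :=
  let I : choiceType := {i : 'I_n & Gs i} in
  @pgroup I [set r | exists (i : 'I_n) (g h : Gs i),
    r = [:: (Tagged (fun i => Gs i) g, true);
            (Tagged (fun i => Gs i) h, true);
            (Tagged (fun i => Gs i) (g * h)%g, false)]].

Definition is_direct_product n (Gs : 'I_n -> groupType) (G : groupType) : Prop :=
  exists p : forall i, {multiplicative G -> Gs i},
    bijective (fun (g : G) (i : 'I_n) => p i g).

(* phi is a homomorphism from G2 to Aut(G1) and e identifies G with the set
   G1 * G2 endowed with the product (a, x)(b, y) = (a phi_x(b), xy). *)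
Definition is_semidirect_product (G1 G2 G : groupType) : Prop :=
  exists (phi : G2 -> {multiplicative G1 -> G1}) (e : G1 * G2 -> G),
    [/\ forall x, bijective (phi x),
        forall x y a, phi (x * y)%g a = phi x (phi y a),
        bijective e &
        forall a x b y,
          (e (a, x) * e (b, y))%g = e ((a * phi x b)%g, (x * y)%g)].

Definition is_finite_index_subgroup (G1 G : groupType) : Prop :=
  exists f : {multiplicative G -> G1}, injective f /\ finite_index (range f).

Record simplicial_complex (V : choiceType) := SimplicialComplex {
  simplices :> set {fset V};
  simplex_neq0 : forall s, simplices s -> s != fset0;
  simplex_face : forall s t, simplices s -> (t `<=` s)%fset -> t != fset0 ->
    simplices t }.

Section OrderComplex.
Variables (V : choiceType) (P : set V) (le : V -> V -> Prop).

Definition chains : set {fset V} :=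
  [set s | [/\ s != fset0, [set` s] `<=` P & total_on [set` s] le]].

Lemma chains_neq0 s : chains s -> s != fset0.
Proof. by case. Qed.

Lemma chains_face s t : chains s -> (t `<=` s)%fset -> t != fset0 -> chains t.
Proof.
move=> [_ sP sle] /fsubsetP ts t0; split=> //.
  by move=> x /ts /sP.
by move=> x y /ts xs /ts ys; exact: sle.
Qed.

Definition order_complex : simplicial_complex V :=
  SimplicialComplex chains_neq0 chains_face.

End OrderComplex.

Section Cosets.
Variable G : groupType.

Definition Hfi : set (set G) :=
  [set H | [/\ is_subgroup H, H <> setT & finite_index H]].

Definition cosets (HH : set (set G)) : set (set G) :=
  [set C | exists2 H, HH H & exists g, C = right_coset H g].

Definition Pfi : set (set G) := cosets Hfi.

Definition order_complex_Pfi : simplicial_complex (set G) :=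
  order_complex Pfi (fun C D => C `<=` D).

Variable HH : set (set G).

Definition nerve : set {fset set G} :=
  [set s | [/\ s != fset0, [set` s] `<=` cosets HH &
               exists g, forall C, C \in s -> C g]].

Lemma nerve_neq0 s : nerve s -> s != fset0.
Proof. by case. Qed.

Lemma nerve_face s t : nerve s -> (t `<=` s)%fset -> t != fset0 -> nerve t.
Proof.
move=> [_ sP [g sg]] /fsubsetP ts t0; split=> //.
  by move=> x /ts /sP.
by exists g => C /ts; exact: sg.
Qed.

Definition nerve_complex : simplicial_complex (set G) :=
  SimplicialComplex nerve_neq0 nerve_face.

End Cosets.

Section Realization.
Variables (R : realType) (V : choiceType) (K : simplicial_complex V).

Record realization := Realization {
  bary :> {fsfun V -> R with 0};
  bary_simplex : simplices K (finsupp bary);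
  bary_ge0 : forall v, 0 <= bary v;
  bary_sum1 : \sum_(v <- finsupp bary) bary v = 1 }.

HB.instance Definition _ := gen_eqMixin realization.
HB.instance Definition _ := gen_choiceMixin realization.

(* The weak topology: A is open iff its trace on each closed simplex
   |s| = {p | finsupp p `<=` s} is open for the Euclidean topology of |s|. *)
Definition weak_open : set_system realization :=
  [set A | forall s, simplices K s -> forall p : realization,
    A p -> (finsupp p `<=` s)%fset ->
    exists2 e : R, 0 < e & forall q : realization,
      (finsupp q `<=` s)%fset -> (forall v, v \in s -> `|q v - p v| < e) ->
      A q].

Lemma weak_openT : weak_open setT.
Proof. by move=> s Ks p _ _; exists 1. Qed.

Lemma weak_openI : setI_closed weak_open.
Proof.
move=> A B oA oB s Ks p [Ap Bp] ps.
have [e e0 Ae] := oA s Ks p Ap ps.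
have [e' e'0 Be] := oB s Ks p Bp ps.
exists (Num.min e e'); first by rewrite lt_min e0.
move=> q qs pq; split; [apply: Ae|apply: Be] => // v /pq.
- by rewrite lt_min => /andP[].
- by rewrite lt_min => /andP[].
Qed.

Lemma weak_open_bigU (I : Type) (f : I -> set realization) :
  (forall i, weak_open (f i)) -> weak_open (\bigcup_i f i).
Proof.
move=> of_ s Ks p [i _ fip] ps; have [e e0 fe] := of_ i s Ks p fip ps.
by exists e => // q qs pq; exists i => //; exact: fe.
Qed.

HB.instance Definition _ :=
  isOpenTopological.Build realization weak_openT weak_openI weak_open_bigU.

End Realization.

Definition contractible (R : realType) (T : topologicalType) : Prop :=
  exists (x0 : T) (H : T * R -> T),
    [/\ {within [set: T] `*` `[0, 1]%classic, continuous H},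
        forall x, H (x, 0) = x &
        forall x, H (x, 1) = x0].

(* Main.v *)
Require Import Defs.
From HB Require Import structures.
From mathcomp Require Import all_boot all_order all_algebra.
From mathcomp Require Import all_classical all_reals all_analysis.
From mathcomp Require Import perm finmap zify ring lra.

(** Every group in the list has a homomorphism to the infinite dihedral group
of all isometries x |-> c + x and x |-> c - x of the integers whose image
contains a translation by some T <> 0, hence is infinite.  Free groups, free
abelian groups, Fuchsian groups of genus at least 2, Artin groups and
Baumslag-Solitar groups even map onto the translations; an infinite right
angled Coxeter group maps onto the whole dihedral group through two generators
that generate freely; a pure braid group has finite index in a braid group,
which is an Artin group; for virtually cyclic groups the homomorphism is a
twisted transfer.  The property passes from quotients to groups and from groups
to finite index subgroups, so G has it in all the cases of the theorem.

Fix such a homomorphism and an element t acting as the translation by T, and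
let c g be the image of 0 under g.  For p > 1 prime to T the set of the g with
p dividing c g is a proper finite index subgroup A.  If H is a subgroup
containing t^E with E T invertible modulo p, then A meets every coset of H, as
c (t^n g) = n T + c g.  So A is an apex of a cone, in the nerve, on all the
cosets of such subgroups (nerve_cone): if finitely many of them have a common
point g, then some t^(E l) g is also in A.  Choosing the exponents E
successively, with p = E |T| + 1, gives an exhaustion F_0, F_1, ... of the
cosets and apexes a_n of F_n with a_n in F_(n+1).

A complex with such a sequence of cones is contractible.  Join the apexes to a
ray a_0 a_1 a_2 ...  A point p is moved in three steps: first the small
barycentric coordinates of p are removed, which leaves its core; then the core
is moved along a segment to the point of the ray at parameter height p; then
the point slides down the ray to a_0.  The segments lie in the complex as soon
as the height bounds the index n of the F_n that contain the vertices of the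
core.  Removing the small coordinates is what makes a continuous choice of the
height possible: only finitely many vertices belong to the cores of the points
close to a given point, whereas the given point may have infinitely many
neighbouring vertices.

For the order complex, a chain of cosets has a common point, so the order
complex is a subcomplex of the nerve.  The map sending a point p of the nerve
to the combination of the intersections of the sets {C : p C > c}, c in ]0, 1[,
takes its values in the order complex.  On the order complex these
intersections are members of the chain itself, so this map is homotopic to the
identity there, and a contraction of the nerve yields one of the order complex
(retract_contractible).

Continuity for the weak topology is checked on finite sets of vertices with
convergence of the barycentric coordinates (finitary_continuous). *)

Set Implicit Arguments.
Unset Strict Implicit.
Unset Printing Implicit Defensive.

Import Order.TTheory GRing.Theory Num.Theory.
Import numFieldNormedType.Exports.

Local Open Scope classical_set_scope.
Local Open Scope ring_scope.

(** * Homomorphisms out of presented groups *)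

Section PresentationLift.
Variables (I : choiceType) (R : set (word I)) (T : groupType) (f : I -> T).

Definition letter_eval (l : I * bool) : T :=
  if l.2 then f l.1 else (f l.1)^-1%g.

Definition word_eval (w : word I) : T := (\prod_(l <- w) letter_eval l)%g.

Lemma word_eval_cat u v : word_eval (u ++ v) = (word_eval u * word_eval v)%g.
Proof. by rewrite /word_eval big_cat. Qed.

Lemma letter_evalV l : letter_eval (linv l) = (letter_eval l)^-1%g.
Proof. by case: l => i [] //=; rewrite /letter_eval /= invgK. Qed.

Lemma word_eval_winv w : word_eval (winv w) = (word_eval w)^-1%g.
Proof.
elim: w => [|l w ih]; first by rewrite /word_eval !big_nil invg1.
rewrite /winv /= rev_cons -cats1 word_eval_cat -/(winv w) ih.
by rewrite /word_eval big_seq1 big_cons letter_evalV invgM.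
Qed.

Lemma word_eval_wgen i : word_eval (wgen i) = f i.
Proof. by rewrite /word_eval big_seq1. Qed.

Lemma word_eval_wpow w n : word_eval (wpow w n) = (word_eval w ^+ n)%g.
Proof.
elim: n => [|n ih]; first by rewrite /word_eval big_nil.
by rewrite /wpow /= word_eval_cat -/(wpow w n) ih expgS.
Qed.

Hypothesis fR : forall r, R r -> word_eval r = 1%g.

Lemma word_eval_cong u v : word_cong R u v -> word_eval u = word_eval v.
Proof.
elim=> {u v} [//|u v _ -> //|u v w _ -> _ //|u v l|u v r Rr].
- by rewrite !word_eval_cat /word_eval !big_cons big_nil letter_evalV mulg1
     mulgV mul1g.
- by rewrite !word_eval_cat (fR Rr) mul1g.
Qed.

(** All representatives of x have the same value, because the relators have the
value 1. *)
Definition pgroup_lift (x : pgroup R) : T := word_eval (repr x).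

Lemma pgroup_lift_pclass w : pgroup_lift (pclass R w) = word_eval w.
Proof. by apply: word_eval_cong; apply/pclassP; rewrite pclassK. Qed.

Lemma pgroup_lift_pgen i : pgroup_lift (pgen R i) = f i.
Proof. by rewrite pgroup_lift_pclass word_eval_wgen. Qed.

Lemma pgroup_liftM : {morph pgroup_lift : x y / (x * y)%g}.
Proof.
move=> x y; rewrite -(pclassK x) -(pclassK y) [(_ * _)%g]pmulE.
by rewrite !pgroup_lift_pclass word_eval_cat.
Qed.

End PresentationLift.

(** * The infinite dihedral group *)

(** The pair (b, c) is the isometry of the integers x |-> c + x if b is false,
and x |-> c - x if b is true; the product is the composition. *)
Definition dinf : Type := (bool * int)%type.
HB.instance Definition _ := Choice.on dinf.

Definition flip (b : bool) (z : int) : int := if b then - z else z.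

Section DihedralLaws.
Implicit Types x y z : dinf.

Definition dinf_mul x y : dinf := (x.1 (+) y.1, x.2 + flip x.1 y.2).
Definition dinf_inv x : dinf := (x.1, - flip x.1 x.2).
Definition dinf_one : dinf := (false, 0).

Lemma dinf_mulA : associative dinf_mul.
Proof.
by move=> [[] x] [[] y] [[] z]; rewrite /dinf_mul /=; congr pair; ring.
Qed.

Lemma dinf_mul1 : left_id dinf_one dinf_mul.
Proof. by move=> [b x]; rewrite /dinf_mul /= add0r. Qed.

Lemma dinf_mulr1 : right_id dinf_one dinf_mul.
Proof. by move=> [[] x]; rewrite /dinf_mul /=; congr pair; ring. Qed.

Lemma dinf_mulV : right_inverse dinf_one dinf_inv dinf_mul.
Proof. by move=> [[] x]; rewrite /dinf_mul /dinf_one /=; congr pair; ring. Qed.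

Lemma dinf_mulVl : left_inverse dinf_one dinf_inv dinf_mul.
Proof. by move=> [[] x]; rewrite /dinf_mul /dinf_one /=; congr pair; ring. Qed.

End DihedralLaws.

HB.instance Definition _ :=
  isGroup.Build dinf dinf_mulA dinf_mul1 dinf_mulr1 dinf_mulVl dinf_mulV.

Lemma dinfM (x y : dinf) :
  (x * y)%g = (x.1 (+) y.1, x.2 + flip x.1 y.2) :> dinf.
Proof. by []. Qed.

Lemma dinfV (x : dinf) : (x^-1)%g = (x.1, - flip x.1 x.2) :> dinf.
Proof. by []. Qed.

Lemma dinf_expg_translation (T : int) n :
  (((false, T) : dinf) ^+ n)%g = (false, n%:Z * T) :> dinf.
Proof.
elim: n => [|n ih]; first by rewrite mul0r.
rewrite expgS ih dinfM /=; congr pair.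
by rewrite -[n.+1]addn1 PoszD; ring.
Qed.

(** A subgroup of the infinite dihedral group is infinite exactly when it
contains a nontrivial translation. *)
Definition has_infinite_dihedral_image (G : groupType) : Prop :=
  exists f : G -> dinf, {morph f : x y / (x * y)%g} /\
    exists (t : G) (T : int), T <> 0 /\ f t = (false, T).

Lemma dihedral_image_pullback (G H : groupType) (f : G -> H) :
  {morph f : x y / (x * y)%g} -> (forall y, exists x, f x = y) ->
  has_infinite_dihedral_image H -> has_infinite_dihedral_image G.
Proof.
move=> fM fsurj [g [gM [t [T [T0 gt]]]]].
exists (g \o f); split; first by move=> x y /=; rewrite fM gM.
by have [u fu] := fsurj t; exists u, T; rewrite /= fu.
Qed.

Lemma dihedral_image_iso (G H : groupType) :
  isomorphic G H -> has_infinite_dihedral_image H ->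
  has_infinite_dihedral_image G.
Proof.
move=> [f [g fg gf]] hH; apply: (dihedral_image_pullback (@gmulfM _ _ f) _ hH) => y.
by exists (g y); rewrite gf.
Qed.

(** The given homomorphisms on the factors have the same target, so they extend
together to the free product. *)
Lemma dihedral_image_free_product n (Gs : 'I_n -> groupType) :
  (1 <= n)%N -> (forall i, has_infinite_dihedral_image (Gs i)) ->
  has_infinite_dihedral_image (free_product Gs).
Proof.
case: n Gs => [//|n] Gs _ hG; pose f i := sval (cid (hG i)).
have hf i := svalP (cid (hG i)).
pose F (x : {i : 'I_n.+1 & Gs i}) : dinf := f (tag x) (tagged x).
have fM i : {morph f i : x y / (x * y)%g} := (hf i).1.
have [_ [t [T [T0 ft]]]] := hf ord0.
eexists; split; first apply: (@pgroup_liftM _ _ _ F).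
  move=> _ [i [g [h ->]]]; rewrite /word_eval !big_cons big_nil /letter_eval /=.
  by rewrite /F /= fM mulg1 mulgA mulgV.
exists (pgen _ (Tagged (fun i => Gs i) t)), T; split=> //.
rewrite pgroup_lift_pgen//.
move=> _ [i [g [h ->]]]; rewrite /word_eval !big_cons big_nil /letter_eval /=.
by rewrite /F /= fM mulg1 mulgA mulgV.
Qed.

Lemma dihedral_image_direct_product n (Gs : 'I_n -> groupType) G :
  (1 <= n)%N -> (forall i, has_infinite_dihedral_image (Gs i)) ->
  is_direct_product Gs G -> has_infinite_dihedral_image G.
Proof.
case: n Gs => [//|n] Gs _ hG [p [q pq qp]].
apply: (@dihedral_image_pullback _ _ (p ord0) (@gmulfM _ _ (p ord0)) _ (hG ord0)) => y.
pose u (i : 'I_n.+1) : Gs i :=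
  if pselect (ord0 = i) is left e then ecast i (Gs i) e y else 1%g.
exists (q u); have /(congr1 (fun h => h ord0)) -> := qp u.
by rewrite /u; case: pselect => // e; rewrite (eq_axiomK e).
Qed.

Lemma dihedral_image_semidirect (G1 G2 G : groupType) :
  has_infinite_dihedral_image G2 -> is_semidirect_product G1 G2 G ->
  has_infinite_dihedral_image G.
Proof.
move=> h2 [phi [e [_ _ [e' ee' e'e] eM]]].
apply: (@dihedral_image_pullback _ _ (fun g => (e' g).2) _ _ h2).
  move=> x y; rewrite -{1}(e'e x) -{1}(e'e y).
  by case: (e' x) (e' y) => a b [c d]; rewrite eM ee'.
by move=> y; exists (e (1%g, y)); rewrite ee'.
Qed.

(** * Cosets and finite index subgroups *)

Section SubgroupTheory.
Variables (G : groupType) (H : set G).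
Hypothesis sgH : is_subgroup H.

Lemma subgroup1 : H 1%g. Proof. by case: sgH. Qed.

Lemma subgroupV x : H x -> H x^-1%g.
Proof. by move=> Hx; rewrite -[_^-1%g]mul1g; apply: sgH.2 => //; exact: subgroup1. Qed.

Lemma subgroupM x y : H x -> H y -> H (x * y)%g.
Proof. by move=> Hx Hy; rewrite -[y]invgK; apply: sgH.2 => //; exact: subgroupV. Qed.

Lemma subgroupX x n : H x -> H (x ^+ n)%g.
Proof.
move=> Hx; elim: n => [|n ih]; first exact: subgroup1.
by rewrite expgS; exact: subgroupM.
Qed.

Lemma mem_right_coset g x : right_coset H g x <-> H (x * g^-1)%g.
Proof.
split; first by move=> [h Hh <-]; rewrite mulgK.
by move=> Hx; exists (x * g^-1)%g; rewrite ?mulgVK.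
Qed.

Lemma right_coset_self g : right_coset H g g.
Proof. by exists 1%g; [exact: subgroup1|rewrite mul1g]. Qed.

Lemma right_coset_eq g h : right_coset H g = right_coset H h <-> H (g * h^-1)%g.
Proof.
split=> [e|Hgh]; first by apply/mem_right_coset; rewrite -e; exact: right_coset_self.
apply/seteqP; split=> x /mem_right_coset Hx; apply/mem_right_coset.
  by rewrite -(mulgVK g x) -mulgA; apply: subgroupM.
rewrite -(mulgVK h x) -mulgA -[(h * g^-1)%g]invgK invgF.
by apply: subgroupM => //; exact: subgroupV.
Qed.

(** Two of the infinitely many cosets of the powers of t coincide. *)
Lemma finite_index_pow t : finite_index H -> exists2 j, (0 < j)%N & H (t ^+ j)%g.
Proof.
move=> fH; apply: contrapT => nj; apply: infinite_nat.
pose F n := right_coset H (t ^+ n)%g.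
have aux m n : (m < n)%N -> F m <> F n.
  move=> mn /esym/right_coset_eq Hmn; apply: nj; exists (n - m)%N.
    by rewrite subn_gt0.
  by rewrite expgnFr// ltnW.
suff: finite_set (F @^-1` [set right_coset H g | g in setT]).
  by apply: sub_finite_set => n _; exists (t ^+ n)%g.
apply: finite_preimage fH => m n _ _ e.
by case: (ltngtP m n) => // h; have := aux _ _ h; rewrite e.
Qed.

End SubgroupTheory.

Section GroupMorphism.
Variables (G H : groupType) (f : G -> H).
Hypothesis fM : {morph f : x y / (x * y)%g}.

Lemma group_morph1 : f 1%g = 1%g.
Proof. by apply: (@mulgI _ (f 1%g)); rewrite -fM !mulg1. Qed.

Lemma group_morphV x : f x^-1%g = (f x)^-1%g.
Proof. by apply: (@mulgI _ (f x)); rewrite -fM !mulgV group_morph1. Qed.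

Lemma group_morphX x n : f (x ^+ n)%g = (f x ^+ n)%g.
Proof.
by elim: n => [|n ih]; [exact: group_morph1|rewrite !expgS fM ih].
Qed.

Lemma range_subgroup : is_subgroup (range f).
Proof.
split; first by exists 1%g => //; rewrite group_morph1.
by move=> _ _ [x _ <-] [y _ <-]; exists (x * y^-1)%g => //; rewrite fM group_morphV.
Qed.

End GroupMorphism.

Lemma dihedral_image_finite_index (G1 G : groupType) :
  has_infinite_dihedral_image G1 -> is_finite_index_subgroup G1 G ->
  has_infinite_dihedral_image G.
Proof.
move=> [g [gM [t [T [T0 gt]]]]] [f [_ fi]].
have [j j0 [u _ fu]] := finite_index_pow (range_subgroup (@gmulfM _ _ f)) t fi.
exists (g \o f); split; first by move=> x y /=; rewrite gmulfM gM.
exists u, (j%:Z * T); split.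
  by apply/eqP; rewrite mulf_neq0//; [lia|exact/eqP].
by rewrite /= fu (group_morphX gM) gt dinf_expg_translation.
Qed.

(** * The listed groups act on the integers *)

Lemma empty_pgroup (I : choiceType) (R : set (word I)) :
  (I -> False) -> finite_set [set: pgroup R].
Proof.
move=> nI; apply: sub_finite_set (finite_set1 (1%g : pgroup R)) => x _ /=.
by rewrite -(pclassK x); case: (repr x) => // l; case: (nI l.1).
Qed.

Lemma isomorphic_infinite (G H : groupType) :
  isomorphic G H -> infinite_set [set: G] -> infinite_set [set: H].
Proof.
move=> [f [g fg gf]] iG fH; apply: iG.
by apply: sub_finite_set (finite_image g fH) => x _; exists (f x).
Qed.

Section Translations.
Variables (I : choiceType) (R : set (word I)) (z : I -> int).

(** The value of a word under the homomorphism to the integers that sends the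
generator i to z i. *)
Definition exponent_sum (w : word I) : int :=
  \sum_(l <- w) (if l.2 then z l.1 else - z l.1).

Lemma word_eval_translation w :
  word_eval (fun i => (false, z i) : dinf) w = (false, exponent_sum w) :> dinf.
Proof.
rewrite /exponent_sum; elim: w => [|[i b] w ih]; first by rewrite /word_eval !big_nil.
rewrite /word_eval !big_cons -/(word_eval _ _) ih /letter_eval /=.
by case: b; rewrite ?dinfV dinfM.
Qed.

Lemma dihedral_image_translation i :
  (forall r, R r -> exponent_sum r = 0) -> z i <> 0 ->
  has_infinite_dihedral_image (pgroup R).
Proof.
move=> zR zi.
have R1 r : R r -> word_eval (fun i => (false, z i) : dinf) r = 1%g.
  by move=> /zR e; rewrite word_eval_translation e.
exists (pgroup_lift (fun i => (false, z i) : dinf)); split; first exact: pgroup_liftM.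
by exists (pgen R i), (z i); split=> //; rewrite pgroup_lift_pgen.
Qed.

Lemma exponent_sum_cat u v : exponent_sum (u ++ v) = exponent_sum u + exponent_sum v.
Proof. exact: big_cat. Qed.

Lemma exponent_sum_winv w : exponent_sum (winv w) = - exponent_sum w.
Proof.
have := word_eval_translation (winv w).
by rewrite word_eval_winv word_eval_translation dinfV /= => -[->].
Qed.

Lemma exponent_sum_wcomm u v : exponent_sum (wcomm u v) = 0.
Proof. by rewrite !exponent_sum_cat !exponent_sum_winv; ring. Qed.

Lemma exponent_sum_wgen i : exponent_sum (wgen i) = z i.
Proof. exact: big_seq1. Qed.

Lemma exponent_sum_wpow w n : exponent_sum (wpow w n) = n%:Z * exponent_sum w.
Proof.
have := word_eval_translation (wpow w n).
by rewrite word_eval_wpow word_eval_translation dinf_expg_translation => -[->].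
Qed.

Lemma exponent_sum_wpowz w (n : int) : exponent_sum (wpowz w n) = n * exponent_sum w.
Proof.
case: n => n; rewrite /wpowz exponent_sum_wpow ?exponent_sum_winv//.
by rewrite NegzE; ring.
Qed.

Lemma exponent_sum_flatten (J : Type) (F : J -> word I) (s : seq J) :
  exponent_sum (flatten [seq F j | j <- s]) = \sum_(j <- s) exponent_sum (F j).
Proof.
elim: s => [|j s ih]; first by rewrite /exponent_sum !big_nil.
by rewrite /= exponent_sum_cat ih big_cons.
Qed.

End Translations.

Lemma dihedral_image_free (I : choiceType) :
  infinite_set [set: free_group I] -> has_infinite_dihedral_image (free_group I).
Proof.
move=> iF; have [i _] : exists i : I, True.
  by apply: contrapT => nI; apply: iF; apply: empty_pgroup => i; apply: nI; exists i.
by apply: (@dihedral_image_translation _ _ (fun=> 1) i).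
Qed.

Lemma dihedral_image_free_abelian (I : choiceType) :
  infinite_set [set: free_abelian_group I] ->
  has_infinite_dihedral_image (free_abelian_group I).
Proof.
move=> iF; have [i _] : exists i : I, True.
  by apply: contrapT => nI; apply: iF; apply: empty_pgroup => i; apply: nI; exists i.
apply: (@dihedral_image_translation _ _ (fun=> 1) i) => // _ [j [k ->]].
exact: exponent_sum_wcomm.
Qed.

Lemma dihedral_image_fuchsian_preserving g d s t (m : 'I_d -> nat) :
  (2 <= g)%N -> has_infinite_dihedral_image (fuchsian_preserving g s t m).
Proof.
move=> g2.
pose z (i : 'I_g + 'I_g + 'I_d + 'I_s + 'I_t) : int :=
  if i is inl (inl (inl (inl _))) then 1 else 0.
apply: (@dihedral_image_translation _ _ z (inl (inl (inl (inl (Ordinal g2)))))) => //.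
move=> _ [[i _ <-]|->]; first by rewrite exponent_sum_wpow exponent_sum_wgen mulr0.
rewrite !exponent_sum_cat !exponent_sum_flatten !big1 ?addr0// => i _.
- exact: exponent_sum_wcomm.
- exact: exponent_sum_wgen.
- exact: exponent_sum_wgen.
- exact: exponent_sum_wgen.
Qed.

Lemma dihedral_image_fuchsian_nonpreserving g d s t (m : 'I_d -> nat) :
  (2 <= g)%N -> has_infinite_dihedral_image (fuchsian_nonpreserving g s t m).
Proof.
case: g => [|[|g]]// _.
(* The squares of the a_i contribute 2 z(a_i), and only a_0 and a_1 have a
   nonzero image: 2 - 2 = 0. *)
pose z (i : 'I_g.+2 + 'I_d + 'I_s + 'I_t) : int :=
  if i is inl (inl (inl j)) then
    (if val j == 0%N then 1 else if val j == 1%N then -1 else 0) else 0.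
apply: (@dihedral_image_translation _ _ z (inl (inl (inl ord0)))) => //.
move=> _ [[i _ <-]|->]; first by rewrite exponent_sum_wpow exponent_sum_wgen mulr0.
rewrite !exponent_sum_cat !exponent_sum_flatten.
rewrite [X in X + _]big1 ?add0r => [|i _]; last exact: exponent_sum_wgen.
rewrite [X in X + _]big1 ?add0r => [|i _]; last exact: exponent_sum_wgen.
rewrite [X in X + _]big1 ?add0r => [|i _]; last exact: exponent_sum_wgen.
rewrite big_enum /= !big_ord_recl big1 => [|i _].
  by rewrite !exponent_sum_wpow !exponent_sum_wgen /=; ring.
by rewrite exponent_sum_wpow exponent_sum_wgen /= mulr0.
Qed.

Lemma exponent_sum_walt (I : choiceType) (i j : I) k :
  exponent_sum (fun=> 1) (walt i j k) = k%:Z.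
Proof.
rewrite /exponent_sum big_map /= big_const_seq count_predT size_iota.
by elim: k => //= k ->; rewrite -[k.+1]addn1 PoszD addrC.
Qed.

(** Both sides of a braid relation have the same length, so all generators can be
sent to the translation by 1. *)
Lemma dihedral_image_artin n (m : 'I_n -> 'I_n -> option nat) :
  infinite_set [set: artin_group m] -> has_infinite_dihedral_image (artin_group m).
Proof.
move=> iF; have [i _] : exists i : 'I_n, True.
  by apply: contrapT => nI; apply: iF; apply: empty_pgroup => i; apply: nI; exists i.
apply: (@dihedral_image_translation _ _ (fun=> 1) i) => // _ [j [l [k [_ _ ->]]]].
by rewrite exponent_sum_cat exponent_sum_winv !exponent_sum_walt subrr.
Qed.

Lemma dihedral_image_baumslag_solitar m n :
  has_infinite_dihedral_image (baumslag_solitar m n).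
Proof.
pose z (b : bool) : int := if b then 1 else 0.
apply: (@dihedral_image_translation _ _ z true) => // _ ->.
rewrite !exponent_sum_cat exponent_sum_winv !exponent_sum_wpowz.
by rewrite !exponent_sum_wgen /z; ring.
Qed.

(** The cosets of the kernel of a homomorphism to a finite group are its fibres,
so they are finitely many. *)
Lemma dihedral_image_pure_braid n (G : groupType) :
  infinite_set [set: G] -> is_pure_braid_group n G -> has_infinite_dihedral_image G.
Proof.
move=> iG [p [f [_ finj fK]]].
apply: (@dihedral_image_finite_index (braid_group n)).
  apply: dihedral_image_artin => fB; apply: iG.
  rewrite -(preimage_setT f); apply: finite_preimage => //.
  by move=> x y _ _; exact: finj.
exists f; split=> //; rewrite fK /finite_index.
apply: sub_finite_set
  (finite_image (fun s => [set b | p b = s]) (@finite_finset _ setT)).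
move=> _ [g _ <-]; exists (p g) => //; apply/seteqP; split.
  move=> x /= px; exists (x * g^-1)%g; rewrite ?mulgVK//=.
  by rewrite gmulfM (group_morphV (@gmulfM _ _ p)) px mulgV.
by move=> _ [h /= ph <-]; rewrite gmulfM ph mul1g.
Qed.

(** The generators commute and are involutions, so every element is a product of
distinct generators, in a fixed order. *)
Lemma finite_coxeter n (m : 'I_n -> 'I_n -> option nat) :
  (forall i j, i != j -> m i j = Some 2%N) -> finite_set [set: coxeter_group m].
Proof.
move=> m2; rewrite /coxeter_group; set R := (X in @pgroup _ X).
pose s i : pgroup R := pgen R i.
have s2 i : (s i * s i)%g = 1%g.
  rewrite [(_ * _)%g]pmulE; apply/pclassP.
  by have := @WCrel _ R [::] [::] (wpow (wgen i) 2); apply; left; exists i.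
have sV i : (s i)^-1%g = s i by apply/esym/divg1_eq; rewrite invgK s2.
have sC i j : (s i * s j = s j * s i)%g.
  have [->//|ij] := eqVneq i j.
  have e : (s i * s j * (s i * s j))%g = 1%g.
    have -> : (s i * s j)%g = pclass R (wgen i ++ wgen j) by exact: (pmulE R).
    rewrite [(_ * _)%g]pmulE; apply/pclassP.
    have := @WCrel _ R [::] [::] (wpow (wgen i ++ wgen j) 2); apply.
    by right; exists i, j, 2%N; split=> //; exact: m2.
  by apply: divg1_eq; rewrite invgM !sV.
pose P (A : {set 'I_n}) l : pgroup R :=
  (\prod_(k <- l) (if k \in A then s k else 1))%g.
have sP i A l : uniq l -> i \in l ->
    exists B, (s i * P A l)%g = P B l.
  move=> ul il; exists (if i \in A then A :\ i else i |: A)%SET.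
  elim: l ul il => [//|k l ih] /= /andP[kl ul]; rewrite inE /P !big_cons -/(P _ l).
  have [ik _|ik /= il] := eqVneq i k; last first.
    rewrite -/(P _ l) -ih// !mulgA; congr (_ * _)%g.
    have -> : (k \in (if i \in A then A :\ i else i |: A)%SET) = (k \in A).
      by case: ifP => _; rewrite !inE eq_sym (negbTE ik).
    by case: (k \in A); rewrite ?mulg1 ?mul1g.
  subst k; rewrite -/(P (if i \in A then A :\ i else i |: A)%SET l).
  have -> : P (if i \in A then A :\ i else i |: A)%SET l = P A l.
    apply: eq_big_seq => j jl; congr (if _ then _ else _).
    have ji : j != i by apply/eqP => ji; move: kl; rewrite -ji jl.
    by case: ifP => _; rewrite !inE (negbTE ji).
  rewrite mulgA; congr (_ * _)%g.
  by case: ifP => iA; rewrite !inE eqxx /= ?mulg1.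
apply: sub_finite_set
  (finite_image (fun A => P A (enum 'I_n)) (@finite_finset _ setT)) => x _.
rewrite -(pclassK x); elim: (repr x) => [|l w [A _ ihA]].
  by exists finset.set0 => //; rewrite /P big1_seq// => i _; rewrite inE.
have -> : pclass R (l :: w) = (s l.1 * pclass R w)%g.
  rewrite -cat1s -(pmulE R [:: l] w); congr (_ * _)%g.
  case: l => i []//; rewrite -[RHS]sV.
  by rewrite /s /pgen; apply/esym; exact: (pinvE R).
have [B eB] := sP l.1 A (enum 'I_n) (enum_uniq _) (mem_enum _ _).
by exists B => //; rewrite -eB ihA.
Qed.

(** As the group is infinite, two generators span no relator, and the group
retracts onto the infinite dihedral group that these two generate. *)
Lemma dihedral_image_right_angled_coxeter n (m : 'I_n -> 'I_n -> option nat) :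
  right_angled m -> infinite_set [set: coxeter_group m] ->
  has_infinite_dihedral_image (coxeter_group m).
Proof.
move=> ra iG.
have [i [j [ij mij]]] : exists i j, i != j /\ m i j = None.
  apply: contrapT => nex; apply: iG; apply: finite_coxeter => i j ij.
  by have [_ [//|mN]] := ra _ _ ij; case: nex; exists i, j.
(* The two reflections x |-> - x and x |-> 1 - x, which generate the infinite
   dihedral group; i and j span no relator, the other generators are killed. *)
pose f k : dinf :=
  if k == i then ((true, 0) : dinf) else if k == j then ((true, 1) : dinf) else 1%g.
have f2 k : (f k * f k)%g = 1%g.
  by rewrite /f; case: ifP => _; [|case: ifP => _]; rewrite ?mulg1.
rewrite /coxeter_group; set R := (X in @pgroup _ X).
have fR r : R r -> word_eval f r = 1%g.
  move=> [[k _ <-]|[k [l [p [kl mkl ->]]]]].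
    by rewrite word_eval_wpow word_eval_wgen expg2.
  have -> : p = 2%N.
    by have [_ [|]] := ra _ _ kl; rewrite mkl // => -[].
  rewrite word_eval_wpow word_eval_cat !word_eval_wgen expg2.
  have [ki|ki] := eqVneq k i.
    have lj : l != j by apply/eqP => lj; move: mkl; rewrite ki lj mij.
    have fl : f l = 1%g by rewrite /f (negbTE lj) -ki eq_sym (negbTE kl).
    by rewrite fl mulg1 f2.
  have [kj|kj] := eqVneq k j; last first.
    by rewrite {1 3}/f (negbTE ki) (negbTE kj) !mul1g f2.
  have li : l != i.
    by apply/eqP => li; move: mkl; rewrite kj li (ra _ _ _).1 ?mij// eq_sym.
  have fl : f l = 1%g by rewrite /f (negbTE li) -kj eq_sym (negbTE kl).
  by rewrite fl mulg1 f2.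
exists (pgroup_lift f); split; first exact: pgroup_liftM.
exists (pgen R i * pgen R j)%g, (-1); split=> //.
rewrite pgroup_liftM// !pgroup_lift_pgen//.
by rewrite /f eqxx [j == i]eq_sym (negbTE ij) eqxx.
Qed.

(** * Virtually cyclic groups *)

Section IntegerPowers.
Variables (G : groupType).
Implicit Types (x : G) (a b : int).

Definition gpowz x a : G :=
  match a with Posz n => (x ^+ n)%g | Negz n => (x ^- n.+1)%g end.

Lemma gpowzS x a : gpowz x (a + 1) = (x * gpowz x a)%g.
Proof.
case: a => [n|[|n]].
- by rewrite -PoszD addn1 /= expgS.
- by rewrite /= expg1 mulgV.
- have -> : Negz n.+1 + 1 = Negz n by rewrite !NegzE; lia.
  by rewrite /= [(x ^+ n.+2)%g]expgSr invgM mulVKg.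
Qed.

Lemma gpowzD x a b : gpowz x (a + b) = (gpowz x a * gpowz x b)%g.
Proof.
elim/int_rec: a => [|n ih|n ih]; first by rewrite add0r mul1g.
  have -> : n.+1%:Z + b = n%:Z + b + 1 by lia.
  have -> : n.+1%:Z = n%:Z + 1 by lia.
  by rewrite !gpowzS ih mulgA.
have e c : gpowz x (- n%:Z + c) = (x * gpowz x (- n.+1%:Z + c))%g.
  by rewrite -gpowzS; congr gpowz; lia.
apply: (@mulgI _ x); rewrite -e ih mulgA; congr (_ * _)%g.
by have := e 0; rewrite !addr0.
Qed.

Lemma gpowzN x a : gpowz x (- a) = (gpowz x a)^-1%g.
Proof. by apply: (@mulgI _ (gpowz x a)); rewrite -gpowzD subrr mulgV. Qed.

Lemma gpowz1 x : gpowz x 1 = x. Proof. by rewrite /= expg1. Qed.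

Lemma gpowzM x a b : gpowz x (a * b) = gpowz (gpowz x a) b.
Proof.
elim/int_rec: b => [|n ih|n ih]; first by rewrite mulr0.
  have -> : a * n.+1%:Z = a + a * n%:Z by lia.
  have -> : n.+1%:Z = 1 + n%:Z by lia.
  by rewrite !gpowzD ih gpowz1.
have -> : a * - n.+1%:Z = - a + a * - n%:Z by lia.
have -> : - n.+1%:Z = - 1 + - n%:Z by lia.
by rewrite !gpowzD ih !gpowzN gpowz1.
Qed.

Lemma cyclic_subgroupE x : cyclic_subgroup x = range (gpowz x).
Proof.
apply/seteqP; split=> y.
  by move=> [k [|] ->]; [exists k|exists (- k%:Z) => //; rewrite gpowzN].
by move=> [[k|k] _ <-]; [exists k; left|exists k.+1; right].
Qed.

Lemma cyclic_is_subgroup x : is_subgroup (cyclic_subgroup x).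
Proof.
rewrite cyclic_subgroupE; split; first by exists 0.
by move=> _ _ [a _ <-] [b _ <-]; exists (a - b) => //; rewrite gpowzD gpowzN.
Qed.

Lemma gpowz_conj x y a : gpowz (y * x * y^-1)%g a = (y * gpowz x a * y^-1)%g.
Proof.
elim/int_rec: a => [|n ih|n ih]; first by rewrite mulg1 mulgV.
  have -> : n.+1%:Z = n%:Z + 1 by lia.
  by rewrite !gpowzS ih !mulgA mulgVK.
have e z : gpowz z (- n%:Z) = (z * gpowz z (- n.+1%:Z))%g.
  by rewrite -gpowzS; congr gpowz; lia.
apply: (@mulgI _ (y * x * y^-1)%g); rewrite -e ih (e x) !mulgA mulgVK.
by [].
Qed.

Lemma gpowz_inj x : infinite_set (cyclic_subgroup x) -> injective (gpowz x).
Proof.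
move=> iC.
have key j : (0 < j)%N -> (x ^+ j)%g <> 1%g.
  move=> j0 xj; apply: iC.
  have xmod i : (x ^+ (i %% j) = x ^+ i)%g.
    by rewrite [in RHS](divn_eq i j) expgnDr mulnC expgnA xj expg1n mul1g.
  apply: sub_finite_set
    (finite_image (fun i => (x ^+ i)%g) (finite_II j)) => _ [k [|] ->].
    by exists (k %% j)%N; rewrite /= ?ltn_mod.
  exists ((k * j.-1) %% j)%N; first by rewrite /= ltn_mod.
  apply: (@mulIg _ (x ^+ k)%g); rewrite mulVg /= xmod -expgnDr addnC -mulnS.
  by rewrite prednK// mulnC expgnA xj expg1n.
have lt a b : a < b -> gpowz x a <> gpowz x b.
  move=> ab e; have e1 : gpowz x (b - a) = 1%g by rewrite gpowzD gpowzN e mulgV.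
  move: e1; have -> : b - a = `|b - a|%N by lia.
  by apply: key; lia.
move=> a b e; case: (ltgtP a b) => // /lt; by rewrite e.
Qed.

End IntegerPowers.

(** Let C be the infinite cyclic subgroup generated by x, of finite index in G.
Some power t of x generates a normal subgroup, on which G acts by a sign phi.
The displacements along the cosets of C define a cocycle c with values in the
integers twisted by phi, the transfer; it is nonzero on t. *)
Section Transfer.
Variables (G : groupType) (x : G).
Let C := cyclic_subgroup x.
Hypotheses (infC : infinite_set C) (fiC : finite_index C).

Let sgC : is_subgroup C := cyclic_is_subgroup x.
Let Q : set (set G) := [set right_coset C g | g in [set: G]].
Let rep (q : set G) : G := xget 1%g q.

Lemma rep_coset g : right_coset C g (rep (right_coset C g)).
Proof. exact/(xgetI _ (right_coset_self sgC g)). Qed.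

Lemma gpowz_memC a : C (gpowz x a).
Proof. by rewrite /C cyclic_subgroupE; exists a. Qed.

Lemma memC_gpowz c : C c -> exists a, c = gpowz x a.
Proof. by rewrite /C cyclic_subgroupE => -[a _ <-]; exists a. Qed.

Lemma coset_gpowz y y' : right_coset C y = right_coset C y' ->
  exists a, y = (gpowz x a * y')%g.
Proof.
move=> /(right_coset_eq sgC)/memC_gpowz[a e]; exists a.
by rewrite -e mulgVK.
Qed.

Lemma coset_gpowzM a y : right_coset C (gpowz x a * y)%g = right_coset C y.
Proof. by apply/(right_coset_eq sgC); rewrite mulgK; exact: gpowz_memC. Qed.

Lemma core_pow : exists2 j, (0 < j)%N & forall g, C (g * x ^+ j * g^-1)%g.
Proof.
have hJ q : exists j, (0 < j)%N /\ C (rep q * x ^+ j * (rep q)^-1)%g.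
  have [j j0 Cj] := finite_index_pow sgC (rep q * x * (rep q)^-1)%g fiC.
  exists j; split=> //.
  by have := gpowz_conj x (rep q) j%:Z; rewrite /= => <-.
have [J {}hJ] := choice hJ.
(* x ^+ j is in the conjugates of C by all the representatives, hence by all
   elements, as each is the product of a power of x and a representative. *)
exists (\prod_(q <- fset_set Q) J q)%N.
  by apply/prodn_gt0 => q; have [] := hJ q.
move=> g; set j := (\prod_(q <- _) _)%N; set q := right_coset C g.
have [j' ej] : exists j', j = (J q * j')%N.
  have qQ : q \in fset_set Q by rewrite in_fset_set// mem_set//; exists g.
  by rewrite /j (big_fsetD1 q)//=; eexists.
have [a ->] : exists a, g = (gpowz x a * rep q)%g.
  apply: coset_gpowz; apply/(right_coset_eq sgC).
  have /(mem_right_coset _) := rep_coset g => /(subgroupV sgC).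
  by rewrite invgF.
have -> : (gpowz x a * rep q * x ^+ j * (gpowz x a * rep q)^-1 =
    gpowz x a * ((rep q * x ^+ j * (rep q)^-1) * (gpowz x a)^-1))%g.
  by rewrite invgM !mulgA.
apply: (subgroupM sgC); first exact: gpowz_memC.
apply: (subgroupM sgC); last by apply: (subgroupV sgC); exact: gpowz_memC.
rewrite ej expgnA.
have := gpowz_conj (x ^+ J q)%g (rep q) j'%:Z; rewrite /= => <-.
by apply: (subgroupX sgC); have [] := hJ q.
Qed.

(** Take the least k > 0 such that x ^+ k is in the normal core K of C.  The
conjugates of x ^+ k are powers of x that lie in K, hence powers of x ^+ k. *)
Lemma normal_pow : exists2 k, (0 < k)%N &
  forall g, exists a, (g * x ^+ k * g^-1)%g = gpowz (x ^+ k)%g a.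
Proof.
pose K := [set c | forall g, C (g * c * g^-1)%g].
have sgK : is_subgroup K.
  split=> [g|c d Kc Kd g]; first by rewrite mulg1 mulgV; exact: subgroup1.
  have -> : (g * (c * d^-1) * g^-1 = (g * c * g^-1) * (g * d * g^-1)^-1)%g.
    by rewrite !invgM invgK !mulgA mulgVK.
  by apply: (subgroupM sgC) => //; exact: subgroupV.
have Kpow c a : K c -> K (gpowz c a).
  by move=> Kc; case: a => n; [|apply: (subgroupV sgK)]; exact: (subgroupX sgK).
have exk : exists k, (0 < k)%N && `[< K (x ^+ k)%g >].
  by have [j j0 Kj] := core_pow; exists j; rewrite j0; apply/asboolP.
case: (ex_minnP exk) => k /andP[k0 /asboolP Kk] kmin.
exists k => // g.
have [a ea] := memC_gpowz (Kk g).
have Ka : K (gpowz x a).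
  move=> h; rewrite -ea.
  have -> : (h * (g * x ^+ k * g^-1) * h^-1 = (h * g) * x ^+ k * (h * g)^-1)%g.
    by rewrite invgM !mulgA.
  exact: Kk.
exists (divz a k); rewrite ea.
have -> : (x ^+ k)%g = gpowz x k by [].
rewrite -gpowzM; congr gpowz.
have r0 : (0 <= modz a k) by apply: modz_ge0; lia.
have rk : (modz a k < k%:Z) by apply: ltz_pmod; lia.
have ae := divz_eq a k.
suff : modz a k = 0 by lia.
apply/eqP; apply: contraT => rN0.
have : (k <= `|modz a k|)%N.
  apply: kmin; apply/andP; split; first by lia.
  apply/asboolP.
  have -> : (x ^+ `|modz a k|)%g = gpowz x (modz a k) by rewrite -[in RHS](gez0_abs r0).
  have -> : modz a k = a + (k%:Z * - divz a k) by lia.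
  by rewrite gpowzD gpowzM; apply: (subgroupM sgK) => //; exact: Kpow.
by lia.
Qed.

Lemma dihedral_image_virtually_cyclic : has_infinite_dihedral_image G.
Proof.
have [k k0 nk] := normal_pow; set t := (x ^+ k)%g in nk.
have tE a : gpowz t a = gpowz x (k%:Z * a) by rewrite gpowzM.
have t_inj : injective (gpowz t).
  move=> a b; rewrite !tE => /(gpowz_inj infC) e.
  by apply: (@mulfI _ k%:Z) => //; lia.
have [phi hphi] := choice nk.
have phiM g h : phi (g * h)%g = phi g * phi h.
  apply: t_inj; rewrite -hphi gpowzM -hphi gpowz_conj -hphi invgM.
  by rewrite !mulgA.
have phi1 : phi 1%g = 1.
  by apply: t_inj; rewrite -hphi gpowz1 mul1g invg1 mulg1.
have phix a : phi (gpowz x a) = 1.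
  apply: t_inj; rewrite -hphi gpowz1.
  have -> : t = gpowz x k by [].
  by rewrite -gpowzN -!gpowzD addrAC subrr add0r.
have phi2 g : phi g * phi g = 1.
  have : phi g * phi g^-1%g = 1 by rewrite -phiM mulgV.
  move/(congr1 absz)/eqP; rewrite abszM muln_eq1 => /andP[/eqP u1 _].
  by have [->|->] : phi g = 1 \/ phi g = -1 by lia.
(* The position of y in its coset C y, which is a copy of the integers. *)
pose A y := xget 0 [set a | y = (gpowz x a * rep (right_coset C y))%g].
have AE y : y = (gpowz x (A y) * rep (right_coset C y))%g.
  apply: (@xgetPex _ 0 [set a | y = (gpowz x a * rep (right_coset C y))%g]).
  apply: coset_gpowz; apply/(right_coset_eq sgC).
  have /(mem_right_coset _) := rep_coset y => /(subgroupV sgC).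
  by rewrite invgF.
have Ax a y : A (gpowz x a * y)%g = a + A y.
  apply: (gpowz_inj infC); apply: (@mulIg _ (rep (right_coset C y))).
  have := AE (gpowz x a * y)%g; rewrite coset_gpowzM => <-.
  by rewrite gpowzD -mulgA -AE.
(* The displacement of position caused by h, with the sign of y: it depends on
   the coset of y only, and its sum over the cosets is the cocycle c. *)
pose D h y := phi y * (A (y * h)%g - A y).
have Dx h a y : D h (gpowz x a * y)%g = D h y.
  by rewrite /D phiM phix mul1r -mulgA !Ax; congr (_ * _); ring.
have Drep h y : D h (rep (right_coset C y)) = D h y.
  by rewrite [in RHS](AE y) Dx.
have DM g h y : D (g * h)%g y = D g y + phi g * D h (y * g)%g.
  rewrite /D phiM mulgA; set d := A (y * g * h)%g - _.
  have -> : phi g * (phi y * phi g * d) = (phi g * phi g) * (phi y * d) by ring.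
  by rewrite phi2 /d; ring.
pose c h := \sum_(q \in Q) D h (rep q).
have finQ F : \sum_(q \in Q) F q = \sum_(q <- fset_set Q) F q :> int.
  exact: fsbig_finite.
have cshift h g : \sum_(q \in Q) D h (rep q * g)%g = c h.
  pose R q := [set (y * g)%g | y in q].
  have RE y : R (right_coset C y) = right_coset C (y * g)%g.
    apply/seteqP; split=> [_ [_ [z Cz <-] <-]|_ [z Cz <-]].
      by exists z => //; rewrite mulgA.
    by exists (z * y)%g; [exists z|rewrite mulgA].
  rewrite /c [RHS](reindex_fsbig R Q Q).
    apply: eq_fsbigr => q /set_mem[y _ <-].
    have [a ya] : exists a, rep (right_coset C y) = (gpowz x a * y)%g.
      apply: coset_gpowz; apply/(right_coset_eq sgC).
      exact/(mem_right_coset _)/rep_coset.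
    by rewrite RE Drep ya -mulgA Dx.
  split; first by move=> _ [y _ <-]; rewrite RE; exists (y * g)%g.
    move=> _ _ /set_mem[y _ <-] /set_mem[z _ <-]; rewrite !RE.
    move=> /(right_coset_eq sgC); rewrite mulgKA => h'.
    exact/(right_coset_eq sgC).
  move=> _ [y _ <-]; exists (right_coset C (y * g^-1)%g); first by exists (y * g^-1)%g.
  by rewrite RE mulgVK.
have cM g h : c (g * h)%g = c g + phi g * c h.
  rewrite -(cshift h g) /c !finQ mulr_sumr -big_split /=.
  by apply: eq_bigr => q _; exact: DM.
have phi_pm g : phi g = if phi g == -1 then -1 else 1.
  by case: eqVneq => // /eqP; have := phi2 g; nia.
exists (fun g => (phi g == -1, c g) : dinf); split.
  move=> g h; rewrite dinfM /= cM phiM; congr pair.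
    by rewrite (phi_pm g) (phi_pm h); case: ifP => _; case: ifP.
  by congr (_ + _); rewrite [in LHS](phi_pm g); case: ifP => _ /=; ring.
have Dt y : D t y = k%:Z.
  rewrite /D; have -> : (y * t)%g = (gpowz x (k%:Z * phi y) * y)%g.
    by rewrite -tE -hphi mulgVK.
  by rewrite Ax; have := phi2 y; nia.
exists t, (c t); split; last by rewrite (phix k).
rewrite /c finQ (eq_bigr (fun=> k%:Z)) => [|q _]; last exact: Dt.
rewrite big_const_seq count_predT iter_addr_0.
have : (0 < size (fset_set Q))%N.
  rewrite -[size _]/(#|` fset_set Q|)%fset cardfs_gt0; apply/fset0Pn.
  by exists (right_coset C 1%g); rewrite in_fset_set// mem_set//; exists 1%g.
by rewrite pmulrn; nia.
Qed.

End Transfer.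

Lemma dihedral_image_listed (G : groupType) :
  listed_group G -> has_infinite_dihedral_image G.
Proof.
move=> [iG _]; case.
- move=> I e; apply: dihedral_image_iso (e) _.
  exact: dihedral_image_free (isomorphic_infinite e iG).
- move=> I e; apply: dihedral_image_iso (e) _.
  exact: dihedral_image_free_abelian (isomorphic_infinite e iG).
- move=> g d s t m g2 _ e; apply: dihedral_image_iso e _.
  exact: dihedral_image_fuchsian_preserving.
- move=> g d s t m g2 _ e; apply: dihedral_image_iso e _.
  exact: dihedral_image_fuchsian_nonpreserving.
- move=> n m ra e; apply: dihedral_image_iso (e) _.
  exact: dihedral_image_right_angled_coxeter ra (isomorphic_infinite e iG).
- move=> n m _ e; apply: dihedral_image_iso (e) _.
  exact: dihedral_image_artin (isomorphic_infinite e iG).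
- by move=> n; exact: dihedral_image_pure_braid.
- move=> m n e; apply: dihedral_image_iso e _.
  exact: dihedral_image_baumslag_solitar.
- by move=> [x [ix fx]]; exact: dihedral_image_virtually_cyclic ix fx.
Qed.

(** * Cones on sets of finite index cosets *)

Section FiniteIndexCosets.
Variable G : groupType.
Implicit Types (H K C : set G) (g : G).

Lemma coset_recenter C g : Pfi C -> C g -> exists2 H, Hfi H & C = right_coset H g.
Proof.
move=> [H hH [h ->]] Cg; exists H => //.
have [sgH _ _] := hH.
by apply/esym/(right_coset_eq sgH); apply/mem_right_coset.
Qed.

Lemma right_cosetI H K g : is_subgroup H -> is_subgroup K ->
  right_coset (H `&` K) g = right_coset H g `&` right_coset K g.
Proof.
move=> sgH sgK; apply/seteqP; split=> x.
  by move=> [h [Hh Kh] <-]; split; exists h.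
by move=> [/(mem_right_coset H) Hx /(mem_right_coset K) Kx]; apply/mem_right_coset.
Qed.

Lemma is_subgroupI H K : is_subgroup H -> is_subgroup K -> is_subgroup (H `&` K).
Proof.
move=> [H1 HM] [K1 KM]; split=> // x y [Hx Kx] [Hy Ky].
by split; [exact: HM|exact: KM].
Qed.

Lemma finite_indexI H K : is_subgroup H -> is_subgroup K ->
  finite_index H -> finite_index K -> finite_index (H `&` K).
Proof.
move=> sgH sgK fH fK.
apply: sub_finite_set (finite_image2 setI fH fK) => _ [g _ <-].
exists (right_coset H g); first by exists g.
by exists (right_coset K g); [exists g|rewrite right_cosetI].
Qed.

Lemma bigcap_cosets (l : seq (set G)) g :
  (forall C, C \in l -> Pfi C /\ C g) ->
  exists K, [/\ is_subgroup K, finite_index K &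
    right_coset K g = [set x | forall C, C \in l -> C x]].
Proof.
elim: l => [_|C l ih hl].
  exists setT; split=> //.
    apply: sub_finite_set (finite_set1 setT) => _ [h _ <-].
    by apply/seteqP; split=> // x _; apply/mem_right_coset.
  by apply/seteqP; split=> // x _; apply/mem_right_coset.
have [|K [sgK fK KE]] := ih; first by move=> D Dl; apply: hl; rewrite inE Dl orbT.
have [PC Cg] := hl C (mem_head _ _).
have [H [sgH _ fH] CE] := coset_recenter PC Cg.
exists (H `&` K); split; [exact: is_subgroupI|exact: finite_indexI|].
rewrite right_cosetI// KE -CE; apply/seteqP; split=> x.
  by move=> [Cx lx] D; rewrite inE => /predU1P[->//|]; exact: lx.
move=> lx; split; first by apply: lx; exact: mem_head.
by move=> D Dl; apply: lx; rewrite inE Dl orbT.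
Qed.

(** Around a common element g, all the cosets are of the form H g, and their
intersection is the coset by g of the intersection of the subgroups. *)
Lemma nerve_bigcap (s : {fset set G}) :
  nerve (@Hfi G) s -> Pfi (\bigcap_(C in [set` s]) C).
Proof.
move=> [/fset0Pn[C Cs] sP [g gs]].
have [|K [sgK fK KE]] := @bigcap_cosets (enum_fset s) g.
  by move=> D Ds; split; [exact: sP|exact: gs].
have -> : \bigcap_(C in [set` s]) C = right_coset K g.
  by rewrite KE.
exists K; last by exists g.
split=> // KT; have [H [sgH HT _] CE] := coset_recenter (sP _ Cs) (gs _ Cs).
apply: HT; apply/seteqP; split=> // x _.
have : right_coset K g (x * g)%g by apply/mem_right_coset; rewrite KT.
rewrite KE => /(_ C Cs); rewrite CE => /(mem_right_coset H).
by rewrite mulgK.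
Qed.

Section Cones.
Variables (f : G -> dinf) (t : G) (T : int).
Hypotheses (fM : {morph f : x y / (x * y)%g}) (T0 : T <> 0) (ft : f t = (false, T)).

Let c g : int := (f g).2.

Definition congruence_subgroup (p : nat) : set G := [set g | (p %| c g)%Z].

Lemma dvdz_flip (p : nat) b z : (p %| flip b z)%Z = (p %| z)%Z.
Proof. by case: b; rewrite //= rpredN. Qed.

Lemma translation_partF x y :
  c (x * y^-1)%g = c x - flip ((f x).1 (+) (f y).1) (c y).
Proof.
rewrite /c fM (group_morphV fM) dinfM dinfV /=.
by case: (f x) (f y) => [[] z] [[] w] /=; ring.
Qed.

Lemma translation_part_pow n g : c (t ^+ n * g)%g = n%:Z * T + c g.
Proof.
by rewrite /c fM (group_morphX fM) ft dinf_expg_translation dinfM.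
Qed.

Lemma congruence_is_subgroup p : is_subgroup (congruence_subgroup p).
Proof.
split; first by rewrite /congruence_subgroup /= /c (group_morph1 fM) dvdz0.
move=> x y /= px py; rewrite /congruence_subgroup /= translation_partF.
by rewrite rpredB// -/(dvdz _ _) dvdz_flip.
Qed.

Lemma congruence_finite_index p : finite_index (congruence_subgroup p.+1).
Proof.
pose F (bz : bool * 'I_p.+1) :=
  [set x | (p.+1 %| c x - flip ((f x).1 (+) bz.1) (bz.2 : nat))%Z].
apply: sub_finite_set (finite_image F (@finite_finset _ setT)) => _ [g _ <-].
pose z := modz (c g) p.+1.
have z0 : 0 <= z by apply: modz_ge0.
have zp : (`|z| < p.+1)%N by have : z < p.+1%:Z := ltz_pmod _ _; lia.
exists ((f g).1, Ordinal zp) => //; rewrite /F /=.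
have zE : `|z|%N = z :> int by lia.
have cgE := divz_eq (c g) p.+1.
have key x : (p.+1 %| c x - flip ((f x).1 (+) (f g).1) `|z|%N)%Z
    = (p.+1 %| c (x * g^-1)%g)%Z.
  rewrite translation_partF zE [in RHS]cgE -/z.
  set b := _ (+) _; set q := divz _ _.
  have -> : c x - flip b (q * p.+1%:Z + z) =
      - flip b q * p.+1%:Z + (c x - flip b z) by case: b => /=; ring.
  by rewrite [RHS]rpredDl//; exact: dvdz_mull.
apply/seteqP; split=> x /=; rewrite ?key.
  by move=> h; apply/mem_right_coset.
move/(mem_right_coset (congruence_subgroup p.+1)).
by rewrite /congruence_subgroup /= -key.
Qed.

(** The exponents E_n are built so that E_n divides E_(n+1), that every positive
integer divides some E_n, and that E_(n+1) is a multiple of the modulus used for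
the n-th apex, which puts that apex in the next stage. *)
Fixpoint level n : nat :=
  if n is m.+1 then (level m * (level m * `|T| + 1) * m.+1)%N else 1%N.

(** Coprime to level n and to T, and larger than |T|: this makes the congruence
subgroup proper and level n * T invertible. *)
Definition modulus n := (level n * `|T| + 1)%N.

Lemma level_gt0 n : (0 < level n)%N.
Proof. by elim: n => //= n ih; rewrite !muln_gt0 ih addn1. Qed.

Lemma level_dvd m n : (m <= n)%N -> (level m %| level n)%N.
Proof.
elim: n => [|n ih]; first by rewrite leqn0 => /eqP->.
rewrite leq_eqVlt => /predU1P[->//|/ih h].
by rewrite /= -mulnA dvdn_mulr.
Qed.

Lemma dvd_level n : (0 < n)%N -> (n %| level n)%N.
Proof. by case: n => // n _ /=; rewrite dvdn_mull. Qed.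

Definition apex n : set G := congruence_subgroup (modulus n).

Lemma apex_Hfi n : Hfi (apex n).
Proof.
rewrite /apex /modulus addn1; split.
- exact: congruence_is_subgroup.
- move=> e; have : congruence_subgroup (level n * `|T|).+1 t by rewrite e.
  rewrite /congruence_subgroup /= /c ft /= dvdzE /= => /dvdn_leq.
  have := level_gt0 n; have : (0 < `|T|)%N by lia.
  move=> T1 L0 /(_ T1); nia.
- exact: congruence_finite_index.
Qed.

Lemma apex_Pfi n : Pfi (apex n).
Proof.
exists (apex n); first exact: apex_Hfi.
exists 1%g; apply/seteqP; split=> x.
  by move=> Ax; apply/mem_right_coset; rewrite invg1 mulg1.
by move/(mem_right_coset (apex n)); rewrite invg1 mulg1.
Qed.

(** For a coset of H, this says that t ^+ level n is in H. *)
Definition stable n C := forall g, C g -> C (t ^+ level n * g)%g.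

Lemma stable_iter n C l g : stable n C -> C g -> C (t ^+ (level n * l) * g)%g.
Proof.
move=> st Cg; elim: l => [|l ih]; first by rewrite muln0 mul1g.
by rewrite mulnS expgnDr -mulgA; exact: st.
Qed.

Lemma stable_leq m n C : (m <= n)%N -> stable m C -> stable n C.
Proof.
move=> /level_dvd/dvdnP[l e] st g Cg.
by rewrite e mulnC; exact: stable_iter.
Qed.

Lemma Pfi_stable C : Pfi C -> exists n, stable n C.
Proof.
move=> [H [sgH _ fH] [h ->]].
have [j j0 Hj] := finite_index_pow sgH t fH.
exists j => g /(mem_right_coset H) Hg; apply/mem_right_coset.
rewrite -mulgA; apply: (subgroupM sgH) => //.
have /dvdnP[l ->] := dvd_level j0.
by rewrite mulnC expgnA; exact: (subgroupX sgH).
Qed.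

Lemma stable_apex n : stable n.+1 (apex n).
Proof.
move=> g; rewrite /apex /congruence_subgroup /= translation_part_pow => cg.
by rewrite rpredD// !PoszM -!mulrA mulrCA dvdz_mulr.
Qed.

Definition least_stable C : set nat :=
  [set n | stable n C /\ forall m, stable m C -> (n <= m)%N].

Definition rank C : nat := xget 0%N (least_stable C).

Lemma rankP C n : stable n C -> stable (rank C) C /\ (rank C <= n)%N.
Proof.
move=> st.
have [m [stm mmin]] : exists m, stable m C /\ forall k, stable k C -> (m <= k)%N.
  have ex : exists k, `[< stable k C >] by exists n; apply/asboolP.
  case: (ex_minnP ex) => m /asboolP stm mmin; exists m; split=> // k /asboolP.
  exact: mmin.
have [str rmin] := @xgetPex _ 0%N (least_stable C) (ex_intro _ m (conj stm mmin)).
by split=> //; exact: rmin.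
Qed.

Lemma rank_apex n : (rank (apex n) <= n.+1)%N.
Proof. exact: (rankP (@stable_apex n)).2. Qed.

(** From a common element g of the cosets, multiplication on the left by powers of
t ^+ level n does not leave any of them, and one of these powers leads into the
apex, as it shifts c g by a multiple of level n * T, invertible modulo the
modulus. *)
Lemma nerve_cone (s : {fset set G}) n : nerve (@Hfi G) s ->
  (forall C, C \in s -> (rank C <= n)%N) -> nerve (@Hfi G) (apex n |` s)%fset.
Proof.
move=> [s0 sP [g gs]] rs.
have st C : C \in s -> stable n C.
  move=> Cs; have [m /rankP[h _]] := Pfi_stable (sP _ Cs).
  exact: stable_leq (rs _ Cs) h.
split.
- by apply/fset0Pn; exists (apex n); rewrite !inE eqxx.
- move=> C /=; rewrite !inE => /predU1P[->|/sP//]; exact: apex_Pfi.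
pose p := modulus n; pose sT : int := if T < 0 then -1 else 1.
(* level n * T = - sT modulo p, so l solves l * (level n * T) + c g = 0. *)
pose l := `|modz (sT * c g) p|%N.
exists (t ^+ (level n * l) * g)%g => C; rewrite !inE => /predU1P[->|Cs]; last first.
  by apply: stable_iter; [exact: st|exact: gs].
rewrite /apex /congruence_subgroup /= translation_part_pow PoszM -/p.
have p0 : 0 < p%:Z by rewrite /p /modulus; lia.
have lE : l%:Z = modz (sT * c g) p.
  by rewrite /l gez0_abs// modz_ge0// gt_eqF.
have e := divz_eq (sT * c g) p; rewrite -lE in e.
set q := divz _ _ in e.
have {e} -> : l%:Z = sT * c g - q * p%:Z by rewrite e; ring.
have pE : p%:Z = (level n)%:Z * (sT * T) + 1.
  rewrite /p /modulus PoszD PoszM; congr (_ * _ + _).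
  by rewrite /sT; case: ifP; lia.
move: (level n)%:Z pE => L pE.
have -> : L * (sT * c g - q * p%:Z) * T + c g =
    p%:Z * (c g - L * q * T) by rewrite pE; ring.
exact: dvdz_mulr.
Qed.
End Cones.

End FiniteIndexCosets.

(** * Realizations and finite sets of vertices *)

Lemma cvg_maxr (R : realType) (T : Type) (F : set_system T) (FF : Filter F)
    (f g : T -> R) (a b : R) :
  f @ F --> a -> g @ F --> b ->
  Num.max (f x) (g x) @[x --> F] --> Num.max a b.
Proof.
move=> fa gb; rewrite maxr_absE.
under eq_cvg do rewrite maxr_absE.
apply: cvgM; last exact: cvg_cst.
by apply: cvgD; [exact: cvgD|apply: cvg_norm; exact: cvgB].
Qed.

Lemma cvg_minr (R : realType) (T : Type) (F : set_system T) (FF : Filter F)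
    (f g : T -> R) (a b : R) :
  f @ F --> a -> g @ F --> b ->
  Num.min (f x) (g x) @[x --> F] --> Num.min a b.
Proof.
move=> fa gb; rewrite minr_absE.
under eq_cvg do rewrite minr_absE.
apply: cvgM; last exact: cvg_cst.
by apply: cvgB; [exact: cvgD|apply: cvg_norm; exact: cvgB].
Qed.

Lemma cvg_bigop (R : realType) (T I : Type) (F : set_system T) (FF : Filter F)
    (op : R -> R -> R) (idx : R) (s : seq I) (f : I -> T -> R) (a : I -> R) :
  (forall g h b c, g @ F --> b -> h @ F --> c ->
     op (g x) (h x) @[x --> F] --> op b c) ->
  (forall i, f i @ F --> a i) ->
  \big[op/idx]_(i <- s) f i x @[x --> F] --> \big[op/idx]_(i <- s) a i.
Proof.
move=> opc fa; elim: s => [|i s ih].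
  by rewrite big_nil; under eq_cvg do rewrite big_nil; exact: cvg_cst.
by rewrite big_cons; under eq_cvg do rewrite big_cons; exact: opc.
Qed.

Lemma cvg_sumr (R : realType) (T I : Type) (F : set_system T) (FF : Filter F)
    (s : seq I) (f : I -> T -> R) (a : I -> R) :
  (forall i, f i @ F --> a i) ->
  \sum_(i <- s) f i x @[x --> F] --> \sum_(i <- s) a i.
Proof. by apply: cvg_bigop => g h b c gb hc; exact: cvgD. Qed.

Section RealizationTheory.
Variables (R : realType) (V : choiceType) (K : simplicial_complex V).
Notation real := (realization R K).
Implicit Types (p q : real) (W : {fset V}).

Lemma realizationP p q : (forall v, p v = q v) -> p = q.
Proof.
case: p q => [f fs f0 f1] [g gs g0 g1] /= fg.
have {}fg : f = g by apply/fsfunP.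
by subst g; congr Realization; exact: Prop_irrelevance.
Qed.

Lemma bary_eq0 p v : v \notin finsupp p -> p v = 0.
Proof. exact: fsfun_dflt. Qed.

Lemma bary_neq0 p v : (p v != 0) = (v \in finsupp p).
Proof. by rewrite mem_finsupp. Qed.

Lemma sum_finsupp p W (F : V -> R) : (finsupp p `<=` W)%fset ->
  (forall v, v \notin finsupp p -> F v = 0) ->
  \sum_(v <- finsupp p) F v = \sum_(v <- W) F v.
Proof. by move=> pW F0; apply: big_fset_incl => // v _; exact: F0. Qed.

Lemma bary_sum_sub p W : (finsupp p `<=` W)%fset -> \sum_(v <- W) p v = 1.
Proof.
move=> pW; rewrite -(bary_sum1 p) (sum_finsupp pW)// => v; exact: bary_eq0.
Qed.

(** The total weight is computed on any finite W, and only the vertices of nonzero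
weight have to span a simplex: a weight that is a sum of several terms is then
summed over W term by term, even if the terms have no common simplex. *)
Lemma exists_realization W (w : V -> R) :
  (forall v, v \notin W -> w v = 0) -> (forall v, 0 <= w v) ->
  \sum_(v <- W) w v = 1 ->
  (exists2 s, simplices K s & forall v, w v != 0 -> v \in s) ->
  exists p : real, forall v, p v = w v.
Proof.
move=> wW w0 w1 [s Ks ws].
pose f : {fsfun V -> R with 0} := [fsfun v in W => w v | 0].
have fE v : f v = w v.
  by rewrite fsfunE; case: ifPn => // /wW.
have fW : (finsupp f `<=` W)%fset.
  by apply/fsubsetP => v; rewrite mem_finsupp fE; apply: contraNT => /wW ->.
have fsum : \sum_(v <- finsupp f) f v = 1.
  rewrite -w1 (big_fset_incl _ fW) => [|v _]; last by move/fsfun_dflt.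
  by apply: eq_bigr => v _; exact: fE.
have Kf : simplices K (finsupp f).
  apply: (simplex_face Ks).
    by apply/fsubsetP => v; rewrite mem_finsupp fE; exact: ws.
  apply/eqP => f0; move: fsum; rewrite f0 big_seq_fset0 => /esym/eqP.
  by rewrite oner_eq0.
have f0 v : 0 <= f v by rewrite fE.
by exists (Realization Kf f0 fsum).
Qed.

(** The trace at p of the Euclidean topology on the points supported in W.  Here W
need not be a simplex, and this matters: homotopies map a simplex into several
simplices on a common finite set of vertices. *)
Definition nbhs_in W p : set_system real :=
  [set A | exists2 e : R, 0 < e & forall q, (finsupp q `<=` W)%fset ->
     (forall v, v \in W -> `|q v - p v| < e) -> A q].

Global Instance nbhs_in_filter W p : Filter (nbhs_in W p).
Proof.
split; first by exists 1.
- move=> A B [e e0 Ae] [d d0 Bd]; exists (Num.min e d); first by rewrite lt_min e0.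
  move=> q qW qp; split; [apply: Ae|apply: Bd] => // v /qp.
  + by rewrite lt_min => /andP[].
  + by rewrite lt_min => /andP[].
- move=> A B AB [e e0 Ae]; exists e => // q qW qp; exact/AB/Ae.
Qed.

Lemma nbhs_in_self W p A : (finsupp p `<=` W)%fset -> nbhs_in W p A -> A p.
Proof. by move=> pW [e e0]; apply=> // v _; rewrite subrr normr0. Qed.

Lemma nbhs_in_sub W p : \forall q \near nbhs_in W p, (finsupp (bary q) `<=` W)%fset.
Proof. by exists 1. Qed.

Lemma cvg_bary W p v : (finsupp p `<=` W)%fset ->
  (fun q : real => q v) @ nbhs_in W p --> p v.
Proof.
move=> pW; apply/cvgrPdist_lt => e e0; exists e => // q qW qp.
have [vW|vW] := boolP (v \in W); first by rewrite distrC; exact: qp.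
rewrite !bary_eq0 ?subrr ?normr0//; apply: contra vW; exact/fsubsetP.
Qed.

Lemma cvg_sum_finsupp W p (F : V -> real -> R) : (finsupp p `<=` W)%fset ->
  (forall q v, v \notin finsupp q -> F v q = 0) ->
  (forall v, F v @ nbhs_in W p --> F v p) ->
  (fun q => \sum_(v <- finsupp q) F v q) @ nbhs_in W p -->
    \sum_(v <- finsupp p) F v p.
Proof.
move=> pW F0 Fp; rewrite (sum_finsupp pW); last exact: F0.
apply: (@cvg_trans _ ((fun q => \sum_(v <- W) F v q) @ nbhs_in W p)).
  apply: near_eq_cvg; near=> q; apply/esym/sum_finsupp; last exact: F0.
  by near: q; exact: nbhs_in_sub.
exact: cvg_sumr.
Unshelve. all: by end_near. Qed.

Lemma cvg_nbhs_in (T : Type) (F : set_system T) (FF : Filter F)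
    (g : T -> real) W (y : real) :
  (\forall z \near F, (finsupp (bary (g z)) `<=` W)%fset) ->
  (forall v, v \in W -> (fun z => g z v) @ F --> y v) ->
  nbhs_in W y `<=` g @ F.
Proof.
move=> gW gv A [e e0 Ae].
have : \forall z \near F, forall v, v \in W -> `|g z v - y v| < e.
  have : forall s : seq V, {subset s <= W} ->
      \forall z \near F, forall v, v \in s -> `|g z v - y v| < e.
    elim=> [_|v s ih sW]; first by near=> z.
    have vW : v \in W by apply: sW; rewrite inE eqxx.
    have := ih (fun u us => sW u (@mem_behead _ (v :: s) u us)).
    have /cvgrPdist_lt/(_ e e0) := gv v vW.
    apply: filterS2 => z zv zs u; rewrite inE => /predU1P[->|]; last exact: zs.
    by rewrite distrC.
  exact.
by apply: filterS2 gW => z zW zy; exact: Ae.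
Unshelve. all: by end_near. Qed.

(** Only finitely many simplices have all their vertices in W. *)
Lemma weak_open_nbhs_in W y U : weak_open U -> U y -> (finsupp y `<=` W)%fset ->
  nbhs_in W y U.
Proof.
move=> oU Uy yW.
have simp (l : seq {fset V}) : exists2 e : R, 0 < e & forall q, finsupp q \in l ->
    (finsupp y `<=` finsupp q)%fset ->
    (forall v, v \in finsupp q -> `|q v - y v| < e) -> U q.
  elim: l => [|s l [e e0 he]]; first by exists 1.
  have [[Ks ys]|nKs] := pselect (simplices K s /\ (finsupp y `<=` s)%fset).
    have [d d0 hd] := oU s Ks y Uy ys.
    exists (Num.min e d); first by rewrite lt_min e0.
    move=> q; rewrite inE => /predU1P[qs|ql] yq qy.
      apply: hd; rewrite ?qs// -qs => v /qy.
      by rewrite lt_min => /andP[].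
    by apply: he => // v /qy; rewrite lt_min => /andP[].
  exists e => // q; rewrite inE => /predU1P[qs yq|]; last exact: he.
  by case: nKs; rewrite -qs; split=> //; exact: bary_simplex.
have [e e0 he] := simp (enum_fset (fpowerset W)).
(* Points at distance less than d of y have a support containing that of y, so
   the only simplices to consider are the supports between that of y and W. *)
have [d d0 hd] : exists2 d : R, 0 < d & forall v, v \in finsupp y -> d <= y v.
  have : forall l : seq V, {subset l <= finsupp y} ->
      exists2 d : R, 0 < d & forall v, v \in l -> d <= y v.
    elim=> [_|v l ih ly]; first by exists 1.
    have [d d0 hd] := ih (fun u us => ly u (@mem_behead _ (v :: l) u us)).
    exists (Num.min d (y v)).
      rewrite lt_min d0 lt0r bary_ge0 andbT bary_neq0.
      by apply: ly; rewrite inE eqxx.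
    move=> u; rewrite inE ge_min => /predU1P[->|/hd ->//].
    by rewrite lexx orbT.
  exact.
exists (Num.min e d); first by rewrite lt_min e0.
move=> q qW qy; apply: he; first by rewrite fpowersetE.
  apply/fsubsetP => v vy; rewrite -bary_neq0.
  have /qy := fsubsetP yW v vy; rewrite lt_min => /andP[_].
  apply: contraTneq => ->; rewrite sub0r normrN -leNgt.
  by rewrite ger0_norm ?bary_ge0// hd.
move=> v /(fsubsetP qW)/qy; by rewrite lt_min => /andP[].
Qed.

End RealizationTheory.

Section FinitaryHomotopy.
Variables (R : realType) (V V' : choiceType).
Variables (K : simplicial_complex V) (L : simplicial_complex V').

(** Joint continuity at (p, t), tested on the points supported in W, with locally
finitely many vertices in the image. *)
Definition finitary_at (f : realization R K -> R -> realization R L)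
    W (p : realization R K) t :=
  exists2 W', (finsupp (f p t) `<=` W')%fset &
    nbhs_in W' (f p t) `<=`
      (fun z => f z.1 z.2) @ filter_prod (nbhs_in W p) (nbhs t).

Definition finitary f := forall W (p : realization R K) t,
  (finsupp p `<=` W)%fset -> finitary_at f W p t.

(** A weak topology is defined by its traces on the simplices, and this remains
true for the product with the real line, by compactness of small intervals. *)
Lemma finitary_continuous f : finitary f ->
  continuous (fun z : realization R K * R => f z.1 z.2).
Proof.
move=> ff [p0 t0] /= A; rewrite nbhsE => -[U [oU Uf] UA].
have key W (p : realization R K) t : (finsupp p `<=` W)%fset -> U (f p t) ->
    \forall z \near filter_prod (nbhs_in W p) (nbhs t), U (f z.1 z.2).
  move=> pW Up; have [W' sW' fW'] := ff W p t pW.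
  by apply: fW'; exact: weak_open_nbhs_in.
have [[B1 B2] [B1p B2t] B12] := key _ _ _ (fsubset_refl _) Uf.
have [/= e e0 eB] := B2t.
(* It remains to find a neighbourhood of p0 that works for all t in a compact
   interval J around t0: the tube lemma, on each simplex. *)
pose J := `[t0 - e / 2, t0 + e / 2]%classic.
have JU t : J t -> U (f p0 t).
  rewrite /J /= in_itv /= => /andP[t1 t2]; apply: (B12 (p0, t)); split => /=.
    exact: nbhs_in_self B1p.
  by apply: eB => /=; rewrite ltr_norml; apply/andP; split; lra.
have oO : open [set p | forall t, J t -> U (f p t)].
  move=> s Ks p pJ ps.
  have /compact_near_coveringP cJ := @segment_compact R (t0 - e / 2) (t0 + e / 2).
  have := cJ _ (nbhs_in s p) (fun q t => U (f q t)) _; apply => t Jt.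
  have [[C1 C2] [C1p C2t] C12] := key s p t ps (pJ t Jt).
  exists (C2, C1) => // -[t' q] /= [C2t' C1q]; exact: (C12 (q, t')).
exists ([set p | forall t, J t -> U (f p t)], J); last first.
  by move=> [p t] /= [pJ Jt]; apply/UA/pJ.
split => /=; first exact: open_nbhs_nbhs.
exists (e / 2) => /=; first by lra.
move=> t /=; rewrite ltr_norml => /andP[t1 t2].
by rewrite /J /= in_itv /=; apply/andP; split; lra.
Qed.

End FinitaryHomotopy.

Lemma finitary_contractible (R : realType) (V : choiceType)
    (K : simplicial_complex V) (f : realization R K -> R -> realization R K) x0 :
  finitary f -> (forall p, f p 0 = p) -> (forall p, f p 1 = x0) ->
  contractible R (realization R K).
Proof.
move=> ff f0 f1; exists x0, (fun z => f z.1 z.2); split=> //.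
exact/continuous_subspaceT/finitary_continuous.
Qed.

(** * Contraction of a complex exhausted by cones *)

Section Ramps.
Variable R : realType.
Implicit Types x y t : R.

Definition clamp x : R := Num.max 0 (Num.min 1 x).

Lemma clamp_ge0 x : 0 <= clamp x.
Proof. by rewrite /clamp le_max lexx. Qed.

Lemma clamp_le1 x : clamp x <= 1.
Proof. by rewrite /clamp ge_max ler01 ge_min lexx. Qed.

Lemma clamp0 x : x <= 0 -> clamp x = 0.
Proof. by move=> x0; rewrite /clamp; apply/max_idPl; rewrite ge_min x0 orbT. Qed.

Lemma clamp1 x : 1 <= x -> clamp x = 1.
Proof. by move=> x1; rewrite /clamp (min_idPl x1); apply/max_idPr. Qed.

Lemma cvg_clamp (T : Type) (F : set_system T) (FF : Filter F) (f : T -> R) a :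
  f @ F --> a -> clamp (f x) @[x --> F] --> clamp a.
Proof.
by move=> fa; apply: cvg_maxr; [exact: cvg_cst|apply: cvg_minr => //; exact: cvg_cst].
Qed.

Definition tent y : R := Num.max 0 (1 - `|y|).

Lemma tent_ge0 y : 0 <= tent y.
Proof. by rewrite /tent le_max lexx. Qed.

Lemma tent0 y : 1 <= `|y| -> tent y = 0.
Proof. by move=> y1; apply/max_idPl; rewrite subr_le0. Qed.

Lemma tentE y : `|y| <= 1 -> tent y = 1 - `|y|.
Proof. by move=> y1; apply/max_idPr; rewrite subr_ge0. Qed.

Variables (V : choiceType) (a : nat -> V).

(** The barycentric coordinates of the point of parameter x on the polygonal ray
with vertices a 0, a 1, a 2, ...  Only the terms n = truncn x and
n = truncn x + 1 can be nonzero. *)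
Definition ray x (v : V) : R :=
  \sum_(n < (Num.truncn x).+2) tent (x - n%:R) * (a n == v)%:R.

Lemma ray_ge0 x v : 0 <= ray x v.
Proof. by apply: sumr_ge0 => n _; rewrite mulr_ge0 ?tent_ge0. Qed.

(** With a fixed number of terms the sum is continuous in x. *)
Lemma ray_widen N x v : ((Num.truncn x).+2 <= N)%N ->
  ray x v = \sum_(n < N) tent (x - n%:R) * (a n == v)%:R.
Proof.
move=> xN; rewrite /ray (big_ord_widen _ (fun n => tent (x - n%:R) * (a n == v)%:R) xN).
rewrite big_mkcond; apply: eq_bigr => n _; case: ltnP => // xn.
rewrite tent0 ?mul0r//.
have h : (Num.truncn x).+2%:R <= n%:R :> R by rewrite ler_nat.
have := truncnS_gt x; rewrite -natr1 in h; move=> h2.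
by rewrite ler0_norm; lra.
Qed.

Lemma ray_split x v : 0 <= x -> let k := Num.truncn x in
  ray x v = (1 - (x - k%:R)) * (a k == v)%:R + (x - k%:R) * (a k.+1 == v)%:R.
Proof.
move=> x0 k; have /andP[kx xk] := truncn_itv x0; rewrite -/k in kx xk.
rewrite /ray !big_ord_recr /= -/k big1 ?add0r => [|n _]; last first.
  rewrite tent0 ?mul0r//; have h : n.+1%:R <= k%:R :> R by rewrite ler_nat.
  by rewrite -natr1 in h; rewrite ger0_norm; lra.
rewrite -natr1 in xk *.
congr (_ * _ + _ * _).
  by rewrite tentE ger0_norm; lra.
by rewrite tentE ler0_norm; lra.
Qed.

Lemma ray_supp x v : 0 <= x -> ray x v != 0 ->
  v = a (Num.truncn x) \/ v = a (Num.truncn x).+1.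
Proof.
move=> x0; rewrite (ray_split v x0) /=.
have [->|_] := eqVneq (a (Num.truncn x)) v; first by left.
have [->|_] := eqVneq (a (Num.truncn x).+1) v; first by right.
by rewrite !mulr0 addr0 eqxx.
Qed.

Lemma ray_sum x (W : {fset V}) : 0 <= x ->
  a (Num.truncn x) \in W -> a (Num.truncn x).+1 \in W ->
  \sum_(v <- W) ray x v = 1.
Proof.
move=> x0 aW a'W; under eq_bigr do rewrite ray_split//.
have delta u : u \in W -> \sum_(v <- W) (u == v)%:R = 1 :> R.
  move=> uW; rewrite (big_fsetD1 u)//= eqxx big1_fset ?addr0// => v.
  by rewrite !inE eq_sym => /andP[/negbTE ->].
by rewrite big_split /= -!mulr_sumr !delta//; ring.
Qed.

Lemma ray0 v : ray 0 v = (v == a 0%N)%:R.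
Proof. by rewrite ray_split//= truncn0 eq_sym; ring. Qed.

Lemma truncn_near x : \forall y \near x, (Num.truncn y <= (Num.truncn x).+1)%N.
Proof.
have x1 : x < (Num.truncn x).+2%:R.
  by apply: lt_trans (truncnS_gt x) _; rewrite ltr_nat.
near=> y; rewrite truncn_le_nat; near: y; exact: lt_nbhsl.
Unshelve. all: by end_near. Qed.

Lemma continuous_ray v x : ray y v @[y --> x] --> ray x v.
Proof.
rewrite (@ray_widen (Num.truncn x).+3)//.
apply: (@cvg_trans _ ((fun y => \sum_(n < (Num.truncn x).+3)
    tent (y - n%:R) * (a n == v)%:R) @ x)).
  apply: near_eq_cvg; near=> y; apply/esym/ray_widen; rewrite !ltnS.
  by near: y; exact: truncn_near.
apply: (cvg_sumr (F := nbhs x)) => n.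
apply: cvgM; last exact: cvg_cst.
apply: cvg_maxr; first exact: cvg_cst.
apply: cvgB; first exact: cvg_cst.
by apply: cvg_norm; apply: cvgB; [exact: cvg_id|exact: cvg_cst].
Unshelve. all: by end_near. Qed.

End Ramps.

(** The vertices of rank at most n span a subcomplex over which a n is the apex of
a cone; the apex a n itself appears at the next stage, so that the subcomplex is
also joined to the whole edge from a n to a n.+1. *)
Section ConeContraction.
Variables (R : realType) (V : choiceType) (K : simplicial_complex V).
Variables (r : V -> nat) (a : nat -> V).
Hypotheses (Ka : forall n, simplices K [fset a n]%fset)
  (ra : forall n, (r (a n) <= n.+1)%N)
  (coneK : forall s n, simplices K s -> (forall v, v \in s -> (r v <= n)%N) ->
     simplices K (a n |` s)%fset).
Notation real := (realization R K).
Implicit Types (p q : real) (W : {fset V}).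

Lemma double_cone s n : simplices K s -> (forall v, v \in s -> (r v <= n)%N) ->
  simplices K (a n.+1 |` (a n |` s))%fset.
Proof.
move=> Ks rs; apply: coneK; first exact: coneK.
by move=> v; rewrite !inE => /predU1P[->|/rs]; [exact: ra|exact: leqW].
Qed.

Lemma ray_edge n : simplices K (a n.+1 |` [fset a n])%fset.
Proof. by apply: coneK => // v; rewrite inE => /eqP ->. Qed.

Definition sqnorm p : R := \sum_(v <- finsupp p) p v ^+ 2.

(** The threshold sqnorm p / 2 depends continuously on p and lies below the largest
coordinate of p: the sum of the squares is an average of the coordinates. *)
Definition excess p v : R := Num.max 0 (p v - sqnorm p / 2).
Definition total_excess p : R := \sum_(v <- finsupp p) excess p v.
Definition core p v : R := excess p v / total_excess p.

(** Coordinates enter linearly, so that small ones count little, and a coordinate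
above the threshold sqnorm p / 2 contributes at least its rank. *)
Definition height p : R := \sum_(v <- finsupp p) 2 * (r v)%:R * p v / sqnorm p.

Lemma finsupp_has p : exists2 v, v \in finsupp p & 0 < p v.
Proof.
have /fset0Pn[v vp] := simplex_neq0 (bary_simplex p).
by exists v => //; rewrite lt0r bary_ge0 andbT bary_neq0.
Qed.

Lemma sqnorm_gt0 p : 0 < sqnorm p.
Proof.
have [v vp v0] := finsupp_has p.
rewrite /sqnorm (big_fsetD1 v)//= ltr_pwDl ?exprn_gt0//.
by apply: sumr_ge0 => u _; exact: sqr_ge0.
Qed.

Lemma excess_ge0 p v : 0 <= excess p v.
Proof. by rewrite /excess le_max lexx. Qed.

Lemma excess_eq0 p v : v \notin finsupp p -> excess p v = 0.
Proof.
move=> vp; apply/max_idPl; rewrite bary_eq0// sub0r oppr_le0.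
by rewrite divr_ge0// ltW// sqnorm_gt0.
Qed.

Lemma total_excess_gt0 p : 0 < total_excess p.
Proof.
rewrite lt0r sumr_ge0 ?andbT => [|v _]; last exact: excess_ge0.
apply/negP; rewrite psumr_eq0 => [|v _]; last exact: excess_ge0.
move/allP => e0.
have le v : v \in finsupp p -> p v <= sqnorm p / 2.
  by move=> /e0 /= /eqP/max_idPl; rewrite subr_le0.
(* All coordinates being at most half of their weighted mean, so is the mean. *)
have : sqnorm p <= sqnorm p / 2.
  have -> : sqnorm p / 2 = \sum_(v <- finsupp p) sqnorm p / 2 * p v.
    by rewrite -mulr_sumr bary_sum1 mulr1.
  rewrite {1}/sqnorm big_seq [leRHS]big_seq.
  by apply: ler_sum => v /le h; rewrite expr2; apply: ler_wpM2r => //; exact: bary_ge0.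
by have := sqnorm_gt0 p; lra.
Qed.

Lemma core_ge0 p v : 0 <= core p v.
Proof. by rewrite divr_ge0 ?excess_ge0// ltW// total_excess_gt0. Qed.

Lemma core_eq0 p v : v \notin finsupp p -> core p v = 0.
Proof. by move=> vp; rewrite /core excess_eq0// mul0r. Qed.

Lemma core_sum p W : (finsupp p `<=` W)%fset -> \sum_(v <- W) core p v = 1.
Proof.
move=> pW; rewrite -(sum_finsupp pW) => [|v]; last exact: core_eq0.
by rewrite -mulr_suml divff// gt_eqF// total_excess_gt0.
Qed.

Lemma height_ge0 p : 0 <= height p.
Proof.
apply: sumr_ge0 => v _; rewrite divr_ge0 ?(ltW (sqnorm_gt0 _))//.
by rewrite !mulr_ge0// bary_ge0.
Qed.

(** The reason for the definition of the height: at the time when the core is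
joined to the ray, its vertices are in the base of the two cones with apexes the
ends of the edge of the ray that is reached. *)
Lemma core_height p v : core p v != 0 -> (r v <= Num.truncn (height p))%N.
Proof.
move=> cv; have vp : v \in finsupp p by apply: contraNT cv => /core_eq0 ->.
have s0 := sqnorm_gt0 p.
have pv : sqnorm p / 2 <= p v.
  rewrite leNgt; apply: contra cv => h; rewrite /core /excess.
  by rewrite (max_idPl _) ?mul0r// subr_le0 ltW.
rewrite truncn_ge_nat ?height_ge0//.
rewrite /height (big_fsetD1 v)//= ler_wpDr//.
  apply: sumr_ge0 => u _; rewrite divr_ge0 ?(ltW s0)//.
  by rewrite !mulr_ge0// bary_ge0.
rewrite ler_pdivlMr// -mulrA mulrCA; apply: ler_wpM2l => //; lra.
Qed.

Definition arrive (t : R) := clamp (3 * t - 1).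
Definition leave (t : R) := clamp (1 - 3 * t).
Definition descent (t : R) := clamp (3 - 3 * t).

(** The point p at time 0, its core at time 1/3, the point of the ray of parameter
height p at time 2/3, and a 0 at time 1; affine in between, except that the
last part follows the ray. *)
Definition cone_weight p t v : R :=
  leave t * p v + (1 - leave t - arrive t) * core p v +
  arrive t * ray a (height p * descent t) v.

Lemma param_ge0 p t : 0 <= height p * descent t.
Proof. by rewrite mulr_ge0 ?height_ge0 ?clamp_ge0. Qed.

(** Never do p and the ray carry weight together, and the core and the ray do so
only while the parameter on the ray is the full height. *)
Lemma stage_cases (t : R) :
  [\/ arrive t = 0, leave t = 0 /\ descent t = 1 |
      leave t = 0 /\ arrive t = 1].
Proof.
have [t1|t1] := leP (3 * t) 1.
  by apply: Or31; apply: clamp0; lra.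
have [t2|t2] := leP (3 * t) 2.
  by apply: Or32; split; [apply: clamp0|apply: clamp1]; lra.
by apply: Or33; split; [apply: clamp0|apply: clamp1]; lra.
Qed.

Lemma stage_sum (t : R) : 0 <= 1 - leave t - arrive t.
Proof.
rewrite /leave /arrive.
have [t1|t1] := leP (3 * t) 1.
  by rewrite [X in _ - X]clamp0 ?subr0 ?subr_ge0 ?clamp_le1//; lra.
by rewrite [X in _ - X - _]clamp0 ?subr0 ?subr_ge0 ?clamp_le1//; lra.
Qed.

Lemma cone_weight_ge0 p t v : 0 <= cone_weight p t v.
Proof.
rewrite /cone_weight !addr_ge0// mulr_ge0 ?clamp_ge0 ?bary_ge0 ?stage_sum//.
  exact: core_ge0.
exact: ray_ge0.
Qed.

Lemma exists_apex : exists p : real, forall v, p v = (v == a 0%N)%:R.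
Proof.
apply: (@exists_realization R V K [fset a 0%N]%fset).
- by move=> v; rewrite inE => /negbTE ->.
- by move=> v; rewrite ler0n.
- by rewrite big_seq_fset1 eqxx.
- by exists [fset a 0%N]%fset => // v; rewrite inE; case: (v == _); rewrite ?eqxx.
Qed.

Lemma cone_weight_supp p t v : cone_weight p t v != 0 ->
  [\/ p v != 0, core p v != 0 | ray a (height p * descent t) v != 0].
Proof.
apply: contra_neqP => h; rewrite /cone_weight.
have [->|n1] := eqVneq (p v) 0; last by case: h; apply: Or31.
have [->|n2] := eqVneq (core p v) 0; last by case: h; apply: Or32.
have [->|n3] := eqVneq (ray a (height p * descent t) v) 0; last by case: h; apply: Or33.
by rewrite !mulr0 !addr0.
Qed.

Lemma exists_cone_path p t : exists q : real, forall v, q v = cone_weight p t v.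
Proof.
set x := height p * descent t; set k := Num.truncn x.
have x0' : 0 <= x := param_ge0 p t.
apply: (@exists_realization _ _ _ (a k.+1 |` (a k |` finsupp p))%fset).
- move=> u; rewrite !inE !negb_or => /and3P[u1 u2 u3].
  apply/eqP; apply: contraT => /cone_weight_supp[].
  + by rewrite bary_neq0 (negbTE u3).
  + by rewrite core_eq0 ?eqxx.
  + by move=> /(ray_supp x0')[] e; rewrite e eqxx in u1 u2.
- exact: cone_weight_ge0.
- rewrite /cone_weight !big_split /= -!mulr_sumr bary_sum_sub; last first.
    by rewrite fsetUA fsubsetUr.
  rewrite core_sum; last by rewrite fsetUA fsubsetUr.
  by rewrite ray_sum ?inE ?eqxx ?orbT//; ring.
have [c0|[l0 d1]|[l0 c1]] := stage_cases t.
- exists (finsupp p); first exact: bary_simplex.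
  move=> u; apply: contraNT => up.
  by rewrite /cone_weight c0 bary_eq0// core_eq0// !mulr0 mul0r !addr0.
- pose s := [fset v in finsupp p | core p v != 0]%fset.
  exists (a k.+1 |` (a k |` s))%fset.
    apply: double_cone.
      apply: simplex_face (bary_simplex p) _ _.
        by apply/fsubsetP => u; rewrite !inE => /andP[].
      have : \sum_(v <- finsupp p) core p v != 0 by rewrite core_sum ?oner_eq0.
      apply: contraNneq => s0; rewrite big1_fset// => u up _.
      apply/eqP; apply: contraT => cu.
      by have : u \in s; [rewrite !inE up cu|rewrite s0 inE].
    move=> u; rewrite !inE => /andP[_ /core_height].
    by rewrite /k /x d1 mulr1.
  move=> u; rewrite !inE.
  have [->|u1] := eqVneq u (a k.+1); first by [].
  have [->|u2] := eqVneq u (a k); first by [].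
  rewrite /= -bary_neq0 /cone_weight l0 mul0r add0r => h.
  have ru : ray a x u = 0.
    by apply/eqP; apply: contraT => /(ray_supp x0')[] e; rewrite e eqxx in u1 u2.
  rewrite ru mulr0 addr0 mulf_eq0 negb_or in h.
  have [_ cu] := andP h; rewrite cu andbT.
  by apply: contraNneq cu => pu; rewrite core_eq0// -bary_neq0 pu eqxx.
- exists (a k.+1 |` [fset a k])%fset; first exact: ray_edge.
  move=> u; rewrite /cone_weight l0 c1 mul0r subr0 subrr mul0r add0r mul1r.
  by rewrite add0r !inE => /(ray_supp x0')[->|->]; rewrite eqxx ?orbT.
Qed.

Definition cone_path p t : real := sval (cid (exists_cone_path p t)).

Lemma cone_pathE p t v : cone_path p t v = cone_weight p t v.
Proof. exact: (svalP (cid (exists_cone_path p t))). Qed.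

Lemma cone_path0 p : cone_path p 0 = p.
Proof.
apply: realizationP => v; rewrite cone_pathE /cone_weight /leave /arrive.
by rewrite [clamp (1 - _)]clamp1 ?[clamp (3 * 0 - 1)]clamp0; lra.
Qed.

Lemma cone_path1 p v : cone_path p 1 v = (v == a 0%N)%:R.
Proof.
rewrite cone_pathE /cone_weight /leave /arrive /descent.
rewrite [clamp (1 - _)]clamp0; last by lra.
rewrite [clamp (3 * 1 - 1)]clamp1; last by lra.
rewrite [clamp (3 - _)]clamp0; last by lra.
by rewrite mulr0 ray0; ring.
Qed.

Lemma cvg_sqnorm W p : (finsupp p `<=` W)%fset -> sqnorm @ nbhs_in W p --> sqnorm p.
Proof.
move=> pW; apply: (@cvg_sum_finsupp _ _ _ W p (fun v q => q v ^+ 2)) => //.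
  by move=> q v vq; rewrite bary_eq0// expr0n.
move=> v; rewrite expr2; under eq_cvg do rewrite expr2.
by apply: cvgM; exact: cvg_bary.
Qed.

Lemma cvg_excess W p v : (finsupp p `<=` W)%fset ->
  (fun q => excess q v) @ nbhs_in W p --> excess p v.
Proof.
move=> pW; apply: cvg_maxr; first exact: cvg_cst.
apply: cvgB; first exact: cvg_bary.
by apply: cvgM; [exact: cvg_sqnorm|exact: cvg_cst].
Qed.

Lemma cvg_core W p v : (finsupp p `<=` W)%fset ->
  (fun q => core q v) @ nbhs_in W p --> core p v.
Proof.
move=> pW; apply: cvgM; first exact: cvg_excess.
apply: cvgV; first by rewrite gt_eqF// total_excess_gt0.
apply: (@cvg_sum_finsupp _ _ _ W p (fun v q => excess q v)) => //.
  by move=> q u; exact: excess_eq0.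
by move=> u; exact: cvg_excess.
Qed.

Lemma cvg_height W p : (finsupp p `<=` W)%fset -> height @ nbhs_in W p --> height p.
Proof.
move=> pW.
apply: (@cvg_sum_finsupp _ _ _ W p (fun v q => 2 * (r v)%:R * q v / sqnorm q)) => //.
  by move=> q v vq; rewrite bary_eq0// mulr0 mul0r.
move=> v; apply: cvgM; first by apply: cvgM; [exact: cvg_cst|exact: cvg_bary].
by apply: cvgV; [rewrite gt_eqF// sqnorm_gt0|exact: cvg_sqnorm].
Qed.

Lemma cone_path_finitary : finitary cone_path.
Proof.
move=> W p t pW.
set F := filter_prod (nbhs_in W p) (nbhs t).
have FF : Filter F by exact: filter_prod_filter.
have cq : fst @ F --> nbhs_in W p by exact: cvg_fst.
have ct : snd @ F --> t by exact: cvg_snd.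
have cx : height z.1 * descent z.2 @[z --> F] --> height p * descent t.
  apply: cvgM; first exact: cvg_comp cq (cvg_height pW).
  apply: cvg_clamp; apply: cvgB; first exact: cvg_cst.
  by apply: cvgM; [exact: cvg_cst|exact: ct].
pose N := (Num.truncn (height p * descent t)).+3.
pose W' := (W `|` [fset a (val i) | i in 'I_N])%fset.
have aW' n : (n < N)%N -> a n \in W'.
  move=> nN; rewrite !inE; apply/orP; right.
  by apply/imfsetP; exists (Ordinal nN).
have supp z : (finsupp (bary z.1) `<=` W)%fset ->
    (Num.truncn (height z.1 * descent z.2) <=
      (Num.truncn (height p * descent t)).+1)%N ->
    (finsupp (bary (cone_path z.1 z.2)) `<=` W')%fset.
  move=> zW zx; apply/fsubsetP => v; rewrite mem_finsupp cone_pathE.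
  case/cone_weight_supp.
  - by rewrite bary_neq0 => /(fsubsetP zW) vW; rewrite inE vW.
  - move=> cv; rewrite inE; apply/orP; left; apply: (fsubsetP zW).
    by apply: contraNT cv => /core_eq0 ->.
  - by move/(ray_supp (param_ge0 _ _)) => [->|->]; apply: aW'; rewrite /N !ltnS // ltnW.
exists W'; first by apply: (supp (p, t)).
apply: cvg_nbhs_in; rewrite -/F.
  have qW : \forall z \near F, (finsupp (bary z.1) `<=` W)%fset.
    exact: (cq _ (nbhs_in_sub W p)).
  have xN : \forall z \near F, (Num.truncn (height z.1 * descent z.2) <=
      (Num.truncn (height p * descent t)).+1)%N.
    exact: (cx _ (truncn_near _)).
  by apply: filterS2 qW xN => z; exact: supp.
move=> v _; rewrite cone_pathE; under eq_cvg do rewrite cone_pathE.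
have cl : leave z.2 @[z --> F] --> leave t.
  apply: cvg_clamp; apply: cvgB; first exact: cvg_cst.
  by apply: cvgM; [exact: cvg_cst|exact: ct].
have cc : arrive z.2 @[z --> F] --> arrive t.
  apply: cvg_clamp; apply: cvgB; last exact: cvg_cst.
  by apply: cvgM; [exact: cvg_cst|exact: ct].
apply: cvgD; [apply: cvgD|]; apply: cvgM => //.
- exact: (@cvg_comp _ _ _ fst (fun q : real => q v) _ _ _ cq
    (@cvg_bary _ _ _ W p v pW)).
- by apply: cvgB => //; apply: cvgB => //; exact: cvg_cst.
- exact: (@cvg_comp _ _ _ fst (fun q : real => core q v) _ _ _ cq
    (@cvg_core W p v pW)).
- exact: (@cvg_comp _ _ _ (fun z : real * R => height z.1 * descent z.2)
    (fun x => ray a x v) _ _ _ cx (@continuous_ray _ _ _ _ _)).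
Unshelve. all: by end_near. Qed.

Lemma exists_cone_contraction : exists (f : real -> R -> real) (x : real),
  [/\ finitary f, forall p, f p 0 = p & forall p, f p 1 = x].
Proof.
have [x xE] := exists_apex; exists cone_path, x.
split; [exact: cone_path_finitary|exact: cone_path0|].
by move=> p; apply: realizationP => v; rewrite cone_path1 xE.
Qed.

End ConeContraction.

(** * Contraction of the subcomplex of nested intersections *)

(** In the intended case L is the nerve of a family of cosets, K the order complex
of that family, and meet the intersection of a finite set of cosets. *)
Section Retraction.
Variables (R : realType) (V : choiceType) (K L : simplicial_complex V).
Variable meet : {fset V} -> V.
Hypotheses (KL : forall s, simplices K s -> simplices L s)
  (meet_nested : forall T : {fset {fset V}}, T != fset0 ->
    (forall A, A \in T -> simplices L A) ->
    (forall A B, A \in T -> B \in T -> (A `<=` B)%fset \/ (B `<=` A)%fset) ->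
    simplices K [fset meet A | A in T]%fset)
  (meet_mem : forall s, simplices K s -> meet s \in s).
Notation realK := (realization R K).
Notation realL := (realization R L).
Implicit Types (p q : realL) (W S : {fset V}).

Lemma bary_le1 p v : p v <= 1.
Proof.
have [vp|/bary_eq0 ->//] := boolP (v \in finsupp p).
rewrite -(bary_sum1 p) (big_fsetD1 v)//= lerDl.
by apply: sumr_ge0 => u _; exact: bary_ge0.
Qed.

Definition inner p S : R := \big[Num.max/0]_(v <- S) (1 - p v).
Definition outer W p S : R :=
  \big[Num.max/0]_(v <- W) (if v \in S then 0 else p v).

(** For nonempty S, the length of the set of the thresholds c in [0, 1] with
{v | p v > c} = S: such c are those between the maximum of p outside S and the
minimum of p on S, here 1 - inner p S.  Maxima of nonnegative numbers are used
on both sides, as they have the neutral element 0. *)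
Definition gap p S : R :=
  if S == fset0 then 0 else Num.max 0 (1 - inner p S - outer (finsupp p) p S).
Definition total_gap p : R := \sum_(S <- fpowerset (finsupp p)) gap p S.

(** Up to normalisation, the measure of the c such that the members of
{v | p v > c} have meet D. *)
Definition retract_weight p (D : V) : R :=
  (\sum_(S <- fpowerset (finsupp p)) gap p S * (meet S == D)%:R) / total_gap p.

Lemma outer_ge0 W p S : 0 <= outer W p S.
Proof.
rewrite /outer; elim/big_ind : _ => // [x y x0 y0|v _].
  by rewrite le_max x0.
by case: ifP => // _; exact: bary_ge0.
Qed.

Lemma le_outer W p S v : v \in W -> (if v \in S then 0 else p v) <= outer W p S.
Proof.
move=> vW; pose F v := if v \in S then 0 else p v.
exact: (@le_bigmax_seq _ _ _ _ 0 v xpredT F).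
Qed.

Lemma outer_widen W p S : (finsupp p `<=` W)%fset ->
  outer (finsupp p) p S = outer W p S.
Proof.
move=> pW; apply/le_anti/andP; split; rewrite {1}/outer big_seq.
  apply: bigmax_le => [|v vp]; first exact: outer_ge0.
  exact/le_outer/(fsubsetP pW).
apply: bigmax_le => [|v vW]; first exact: outer_ge0.
have [vp|vp] := boolP (v \in finsupp p).
  exact: le_outer.
by rewrite bary_eq0// if_same; exact: outer_ge0.
Qed.

Lemma gap_ge0 p S : 0 <= gap p S.
Proof. by rewrite /gap; case: ifP => // _; rewrite le_max lexx. Qed.

Lemma gap_lt p S v u : gap p S != 0 -> v \in S -> u \notin S -> p u < p v.
Proof.
rewrite /gap; case: ifP => [_|_]; first by rewrite eqxx.
move=> g0 vS uS.
have {}g0 : 0 < 1 - inner p S - outer (finsupp p) p S.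
  by rewrite ltNge; apply: contra g0 => h; apply/eqP/max_idPl.
have h1 : 1 - p v <= inner p S.
  exact: (@le_bigmax_seq _ _ _ _ 0 v xpredT (fun v => 1 - p v)).
have h2 : p u <= outer (finsupp p) p S.
  have [up|/bary_eq0 ->] := boolP (u \in finsupp p); last exact: outer_ge0.
  by have := le_outer p S up; rewrite (negbTE uS).
by lra.
Qed.

Lemma gap_neq0 p S : gap p S != 0 -> S != fset0.
Proof. by rewrite /gap; case: ifP; rewrite ?eqxx. Qed.

Lemma gap_sub p S : gap p S != 0 -> (S `<=` finsupp p)%fset.
Proof.
move=> g0; apply/fsubsetP => v vS; apply: contraT => vp.
move: g0; rewrite /gap; case: ifP => _; first by rewrite eqxx.
have h1 : 1 - p v <= inner p S.
  exact: (@le_bigmax_seq _ _ _ _ 0 v xpredT (fun v => 1 - p v)).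
have h2 := outer_ge0 (finsupp p) p S.
by rewrite (max_idPl _) ?eqxx//; rewrite bary_eq0 in h1 => //; lra.
Qed.

(** Sets of the form {p > c} form a chain. *)
Lemma gap_nested p S T : gap p S != 0 -> gap p T != 0 ->
  (S `<=` T)%fset \/ (T `<=` S)%fset.
Proof.
move=> gS gT; have [|/fsubsetPn[v vS vT]] := boolP (S `<=` T)%fset; first by left.
right; apply/fsubsetP => u uT; apply: contraT => uS.
by have := lt_trans (gap_lt gS vS uS) (gap_lt gT uT vT); rewrite ltxx.
Qed.

Lemma seq_argmax (f : V -> R) (s : seq V) : s != [::] ->
  exists2 v, v \in s & forall u, u \in s -> f u <= f v.
Proof.
elim: s => // v [|w s] ih _.
  by exists v; rewrite ?mem_head// => u; rewrite inE => /eqP ->.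
have [//|x xs xmax] := ih.
have [vx|xv] := leP (f v) (f x).
  by exists x; [rewrite inE xs orbT|move=> u; rewrite inE => /predU1P[->|/xmax]].
exists v; first exact: mem_head.
by move=> u; rewrite inE => /predU1P[->//|/xmax/le_trans]; apply; exact: ltW.
Qed.

Lemma total_gap_gt0 p : 0 < total_gap p.
Proof.
have [|v vp vmax] := @seq_argmax p (enum_fset (finsupp p)).
  have := simplex_neq0 (bary_simplex p); apply: contra_neq => e.
  apply/fsetP => v; rewrite inE /=.
  by rewrite -[v \in finsupp p]/(v \in enum_fset (finsupp p)) e.
have v0 : 0 < p v by rewrite lt0r bary_ge0 andbT bary_neq0.
(* The set where p is maximal has a positive gap. *)
pose S := [fset u in finsupp p | p u == p v]%fset.
have Sp : S \in fpowerset (finsupp p).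
  by rewrite fpowersetE; apply/fsubsetP => u; rewrite !inE => /andP[].
have vS : v \in S by rewrite !inE vp eqxx.
rewrite /total_gap (big_fsetD1 S)//= ltr_pwDl//; last first.
  by apply: sumr_ge0 => T _; exact: gap_ge0.
rewrite /gap ifF; last by apply/negbTE/fset0Pn; exists v.
have h1 : inner p S <= 1 - p v.
  rewrite /inner big_seq; apply: bigmax_le => [|u]; first by rewrite subr_ge0 bary_le1.
  by rewrite !inE => /andP[_ /eqP ->].
have h2 : outer (finsupp p) p S < p v.
  rewrite /outer big_seq; apply: bigmax_lt => // u up.
  case: ifPn => // uS; rewrite lt_neqAle vmax// andbT.
  by apply: contra uS => e; rewrite !inE up.
by rewrite lt_max; apply/orP; right; lra.
Qed.

Lemma retract_weight_ge0 p D : 0 <= retract_weight p D.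
Proof.
rewrite divr_ge0 ?(ltW (total_gap_gt0 p))//; apply: sumr_ge0 => S _.
by rewrite mulr_ge0 ?gap_ge0.
Qed.

Lemma retract_weight_supp p D : retract_weight p D != 0 ->
  exists S, gap p S != 0 /\ D = meet S.
Proof.
move=> RD; apply: contrapT => nex; move/eqP: RD; apply.
rewrite /retract_weight big1 ?mul0r// => S _.
have [->|g0] := eqVneq (gap p S) 0; first by rewrite mul0r.
have [e|_] := eqVneq (meet S) D; last by rewrite mulr0.
by case: nex; exists S.
Qed.

Lemma retract_weight_sum p W :
  (forall S, (S `<=` finsupp p)%fset -> S != fset0 -> meet S \in W) ->
  \sum_(D <- W) retract_weight p D = 1.
Proof.
move=> mW; rewrite /retract_weight -mulr_suml exchange_big /=.
rewrite [X in X / _](_ : _ = total_gap p) ?divff ?gt_eqF ?total_gap_gt0//.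
rewrite /total_gap big_seq [RHS]big_seq; apply: eq_bigr => S.
rewrite fpowersetE => Sp; rewrite -mulr_sumr.
have [->|g0] := eqVneq (gap p S) 0; first by rewrite mul0r.
have mS : meet S \in W by apply: mW => //; exact: gap_neq0 g0.
rewrite (big_fsetD1 (meet S))//= eqxx big1_fset ?addr0 ?mulr1// => D.
by rewrite !inE eq_sym => /andP[/negbTE ->].
Qed.

Lemma retract_simplex p :
  exists2 s, simplices K s & forall D, retract_weight p D != 0 -> D \in s.
Proof.
pose T := [fset S in fpowerset (finsupp p) | gap p S != 0]%fset.
have memT S : (S \in T) = (gap p S != 0).
  rewrite !inE /= fpowersetE; apply: andb_idl; exact: gap_sub.
exists [fset meet A | A in T]%fset.
  apply: meet_nested.
  - apply/fset0Pn; have := total_gap_gt0 p; rewrite lt0r => /andP[+ _].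
    move=> t0; apply: contrapT => nT; move/eqP: t0; apply.
    rewrite /total_gap big1// => S _; apply/eqP; apply: contraT => gS.
    by case: nT; exists S; rewrite memT.
  - move=> A; rewrite memT => gA.
    exact: (simplex_face (bary_simplex p) (gap_sub gA) (gap_neq0 gA)).
  - by move=> A B; rewrite !memT; exact: gap_nested.
move=> D /retract_weight_supp[S [gS ->]].
by apply/imfsetP; exists S => //; rewrite memT.
Qed.

Lemma exists_retract p : exists x : realK, forall D, x D = retract_weight p D.
Proof.
pose W := [fset meet S | S in fpowerset (finsupp p)]%fset.
have mW S : (S `<=` finsupp p)%fset -> meet S \in W.
  by move=> Sp; apply/imfsetP; exists S; rewrite //= fpowersetE.
apply: (@exists_realization _ _ _ W).
- move=> D DW; apply/eqP; apply: contraT => /retract_weight_supp[S [gS e]].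
  by rewrite e mW// gap_sub in DW.
- exact: retract_weight_ge0.
- by apply: retract_weight_sum => S Sp _; exact: mW.
- exact: retract_simplex.
Qed.

Definition retract p : realK := sval (cid (exists_retract p)).

Lemma retractE p D : retract p D = retract_weight p D.
Proof. exact: (svalP (cid (exists_retract p))). Qed.

Definition subcomplex_incl (x : realK) : realL :=
  Realization (KL (bary_simplex x)) (bary_ge0 x) (bary_sum1 x).

(** On a simplex of K the retraction stays in the simplex, by meet_mem.  So the
segment from a point to its image lies in K. *)
Lemma retract_subcomplex x D :
  retract_weight (subcomplex_incl x) D != 0 -> D \in finsupp x.
Proof.
case/retract_weight_supp => S [gS ->].
have Sx : (S `<=` finsupp x)%fset by exact: gap_sub gS.
apply: (fsubsetP Sx); apply: meet_mem.
exact: (simplex_face (bary_simplex x) Sx (gap_neq0 gS)).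
Qed.

Lemma cvg_gap W p S : (finsupp p `<=` W)%fset ->
  (fun q => gap q S) @ nbhs_in W p --> gap p S.
Proof.
move=> pW; rewrite /gap; case: ifP => _; first exact: cvg_cst.
apply: cvg_maxr; first exact: cvg_cst.
apply: cvgB.
  apply: cvgB; first exact: cvg_cst.
  apply: cvg_bigop => [g h b c gb hc|v]; first exact: cvg_maxr.
  by apply: cvgB; [exact: cvg_cst|exact: cvg_bary].
rewrite (outer_widen _ pW).
apply: (@cvg_trans _ ((fun q => outer W q S) @ nbhs_in W p)).
  apply: near_eq_cvg; near=> q; apply/esym/outer_widen.
  by near: q; exact: nbhs_in_sub.
apply: cvg_bigop => [g h b c gb hc|v]; first exact: cvg_maxr.
by case: ifP => _; [exact: cvg_cst|exact: cvg_bary].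
Unshelve. all: by end_near. Qed.

Lemma sum_gap_widen W p (F : {fset V} -> R) : (finsupp p `<=` W)%fset ->
  \sum_(S <- fpowerset (finsupp p)) gap p S * F S =
  \sum_(S <- fpowerset W) gap p S * F S.
Proof.
move=> pW; apply: big_fset_incl; first by rewrite fpowersetS.
move=> S _; rewrite fpowersetE => Sp.
have [->|/gap_sub h] := eqVneq (gap p S) 0; first by rewrite mul0r.
by rewrite h in Sp.
Qed.

Lemma cvg_sum_gap W p (F : {fset V} -> R) : (finsupp p `<=` W)%fset ->
  (fun q => \sum_(S <- fpowerset (finsupp q)) gap q S * F S) @ nbhs_in W p -->
  \sum_(S <- fpowerset (finsupp p)) gap p S * F S.
Proof.
move=> pW; rewrite (sum_gap_widen _ pW).
apply: (@cvg_trans _ ((fun q => \sum_(S <- fpowerset W) gap q S * F S) @ nbhs_in W p)).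
  apply: near_eq_cvg; near=> q; apply/esym/sum_gap_widen.
  by near: q; exact: nbhs_in_sub.
by apply: cvg_sumr => S; apply: cvgM; [exact: cvg_gap|exact: cvg_cst].
Unshelve. all: by end_near. Qed.

Lemma cvg_retract_weight W p D : (finsupp p `<=` W)%fset ->
  (fun q => retract_weight q D) @ nbhs_in W p --> retract_weight p D.
Proof.
move=> pW; rewrite /retract_weight; apply: cvgM.
  exact: (@cvg_sum_gap W p (fun S => (meet S == D)%:R) pW).
apply: cvgV; first by rewrite gt_eqF ?total_gap_gt0.
have e q : total_gap q = \sum_(S <- fpowerset (finsupp q)) gap q S * 1.
  by apply: eq_bigr => S _; rewrite mulr1.
rewrite e; under eq_cvg do rewrite e.
exact: (@cvg_sum_gap W p (fun=> 1) pW).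
Qed.

Section Contraction.
Variables (f : realL -> R -> realL) (x1 : realL).
Hypotheses (ff : finitary f) (f0 : forall p, f p 0 = p) (f1 : forall p, f p 1 = x1).

Definition first_half (t : R) := clamp (1 - 2 * t).
Definition second_half (t : R) := clamp (2 * t - 1).

(** First the segment from x to its retraction, then the retraction of the path
that contracts x in L. *)
Definition retract_path_weight (x : realK) t D : R :=
  first_half t * x D +
  (1 - first_half t) * retract_weight (f (subcomplex_incl x) (second_half t)) D.

Lemma exists_retract_path x t :
  exists y : realK, forall D, y D = retract_path_weight x t D.
Proof.
set q := f (subcomplex_incl x) (second_half t).
pose W := (finsupp x `|` [fset meet S | S in fpowerset (finsupp q)])%fset.
have mW S : (S `<=` finsupp q)%fset -> meet S \in W.
  move=> Sq; rewrite inE; apply/orP; right.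
  by apply/imfsetP; exists S; rewrite //= fpowersetE.
have xW : (finsupp x `<=` W)%fset by exact: fsubsetUl.
apply: (@exists_realization _ _ _ W).
- move=> D DW; rewrite /retract_path_weight bary_eq0; last first.
    by apply: contra DW; exact: (fsubsetP xW).
  rewrite mulr0 add0r; apply/eqP; rewrite mulf_eq0; apply/orP; right.
  apply: contraT => /retract_weight_supp[S [gS e]].
  by rewrite e mW// gap_sub in DW.
- move=> D; rewrite /retract_path_weight addr_ge0// mulr_ge0 ?clamp_ge0 ?bary_ge0//.
    by rewrite subr_ge0 clamp_le1.
  exact: retract_weight_ge0.
- rewrite /retract_path_weight big_split /= -!mulr_sumr bary_sum_sub//.
  by rewrite retract_weight_sum => [|S Sq _]; [ring|exact: mW].
have [t1|t1] := leP (2 * t) 1.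
  exists (finsupp x); first exact: bary_simplex.
  move=> D; rewrite /retract_path_weight.
  have -> : second_half t = 0 by apply: clamp0; lra.
  rewrite f0; apply: contraNT => Dx; rewrite bary_eq0// mulr0 add0r.
  rewrite mulf_eq0; apply/orP; right; apply: contraNT Dx.
  exact: retract_subcomplex.
have [s Ks qs] := retract_simplex q; exists s => // D.
rewrite /retract_path_weight.
have -> : first_half t = 0 by apply: clamp0; lra.
by rewrite mul0r add0r subr0 mul1r; exact: qs.
Qed.

Definition retract_path x t : realK := sval (cid (exists_retract_path x t)).

Lemma retract_pathE x t D : retract_path x t D = retract_path_weight x t D.
Proof. exact: (svalP (cid (exists_retract_path x t))). Qed.

Lemma retract_path0 x : retract_path x 0 = x.
Proof.
apply: realizationP => D; rewrite retract_pathE /retract_path_weight /first_half.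
by rewrite clamp1; [ring|lra].
Qed.

Lemma retract_path1 x : retract_path x 1 = retract x1.
Proof.
apply: realizationP => D; rewrite retract_pathE retractE /retract_path_weight.
rewrite /first_half /second_half clamp0; last by lra.
by rewrite clamp1 ?f1; [ring|lra].
Qed.

Lemma retract_path_finitary : finitary retract_path.
Proof.
move=> W x t xW; pose F := filter_prod (nbhs_in W x) (nbhs t).
have FF : Filter F by exact: filter_prod_filter.
have cq : fst @ F --> nbhs_in W x by exact: cvg_fst.
have ct : snd @ F --> t by exact: cvg_snd.
have ci : subcomplex_incl z.1 @[z --> F] --> nbhs_in W (subcomplex_incl x).
  have h : nbhs_in W (subcomplex_incl x) `<=` subcomplex_incl @ nbhs_in W x.
    by move=> A [e e0 Ae]; exists e => // q qW qx; exact: Ae.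
  by move=> A /h /cq.
have c1 : first_half z.2 @[z --> F] --> first_half t.
  apply: cvg_clamp; apply: cvgB; first exact: cvg_cst.
  by apply: cvgM; [exact: cvg_cst|exact: ct].
have c2 : second_half z.2 @[z --> F] --> second_half t.
  apply: cvg_clamp; apply: cvgB; last exact: cvg_cst.
  by apply: cvgM; [exact: cvg_cst|exact: ct].
have iW : (finsupp (subcomplex_incl x) `<=` W)%fset by [].
have [W1 sW1 fW1] := ff (second_half t) iW.
have cf : f (subcomplex_incl z.1) (second_half z.2) @[z --> F] -->
    nbhs_in W1 (f (subcomplex_incl x) (second_half t)).
  move=> A /fW1 [[A1 A2] [/= A1i A2i] A12].
  have A1F : \forall z \near F, A1 (subcomplex_incl z.1) by exact: (ci _ A1i).
  have A2F : \forall z \near F, A2 (second_half z.2) by exact: (c2 _ A2i).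
  by apply: filterS2 A1F A2F => z /= z1 z2; exact: (A12 (_, _)).
pose W' := (W `|` [fset meet S | S in fpowerset W1])%fset.
have supp z : (finsupp (bary z.1) `<=` W)%fset ->
    (finsupp (bary (f (subcomplex_incl z.1) (second_half z.2))) `<=` W1)%fset ->
    (finsupp (bary (retract_path z.1 z.2)) `<=` W')%fset.
  move=> zW fz; apply/fsubsetP => D; rewrite mem_finsupp retract_pathE.
  apply: contraNT; rewrite inE negb_or => /andP[DW DW1].
  rewrite /retract_path_weight bary_eq0 ?mulr0 ?add0r; last first.
    by apply: contra DW; exact: (fsubsetP zW).
  rewrite mulf_eq0; apply/orP; right; apply: contraNT DW1.
  case/retract_weight_supp => S [gS ->]; apply/imfsetP; exists S => //=.
  by rewrite fpowersetE; exact: fsubset_trans (gap_sub gS) fz.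
exists W'; first by apply: (supp (x, t)).
apply: cvg_nbhs_in; rewrite -/F.
  have qW : \forall z \near F, (finsupp (bary z.1) `<=` W)%fset.
    exact: (cq _ (nbhs_in_sub W x)).
  have fW : \forall z \near F,
      (finsupp (bary (f (subcomplex_incl z.1) (second_half z.2))) `<=` W1)%fset.
    exact: (cf _ (nbhs_in_sub W1 _)).
  by apply: filterS2 qW fW => z; exact: supp.
move=> D _; rewrite retract_pathE; under eq_cvg do rewrite retract_pathE.
apply: cvgD; apply: cvgM => //.
- exact: (@cvg_comp _ _ _ fst (fun q : realK => q D) _ _ _ cq
    (@cvg_bary _ _ _ W x D xW)).
- by apply: cvgB => //; exact: cvg_cst.
- exact: (@cvg_comp _ _ _ (fun z => f (subcomplex_incl z.1) (second_half z.2))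
    (fun q : realL => retract_weight q D) _ _ _ cf (@cvg_retract_weight W1 _ D sW1)).
Qed.

Lemma retract_contractible : contractible R realK.
Proof.
exact: finitary_contractible retract_path_finitary retract_path0 retract_path1.
Qed.

End Contraction.

End Retraction.

(** * The nerve and the order complex of the cosets *)

Section CosetComplexes.
Variable G : groupType.
Implicit Types (s A B : {fset set G}).

Definition common_part s : set G := \bigcap_(C in [set` s]) C.

Lemma chain_least (l : seq (set G)) : l != [::] ->
  (forall C D, C \in l -> D \in l -> C `<=` D \/ D `<=` C) ->
  exists2 C, C \in l & forall D, D \in l -> C `<=` D.
Proof.
elim: l => // C [|C' l] ih _ tot.
  by exists C; rewrite ?mem_head// => D; rewrite inE => /eqP ->.
have [//||D Dl Dmin] := ih.
  by move=> A B Al Bl; apply: tot; rewrite inE ?Al ?Bl orbT.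
have DCl : D \in [:: C, C' & l] by rewrite inE Dl orbT.
have [CD|DC] := tot C D (mem_head _ _) DCl.
  exists C; first exact: mem_head.
  by move=> E; rewrite inE => /predU1P[->//|/Dmin]; exact: subset_trans.
exists D => //.
by move=> E; rewrite inE => /predU1P[->//|/Dmin].
Qed.

(** A finite chain has a least member, which is the intersection. *)
Lemma common_part_chain s : chains (@Pfi G) (fun C D : set G => C `<=` D) s ->
  common_part s \in s.
Proof.
move=> [s0 _ tot].
have [||C Cs Cmin] := @chain_least (enum_fset s).
- apply: contra_neq s0 => e; apply/fsetP => C.
  by rewrite inE /= -[C \in s]/(C \in enum_fset s) e.
- by move=> C D Cs Ds; exact: tot.
suff -> : common_part s = C by [].
apply/seteqP; split=> x; first by apply.
by move=> Cx D /Cmin; apply.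
Qed.

Lemma chain_nerve s : chains (@Pfi G) (fun C D : set G => C `<=` D) s ->
  nerve (@Hfi G) s.
Proof.
move=> cs; have [s0 sP _] := cs; have ms := common_part_chain cs.
split=> //; have [H [sgH _ _] [g e]] := sP _ ms.
exists g => C Cs; have : common_part s g by rewrite e; exact: right_coset_self.
exact.
Qed.

Lemma common_part_nested (T : {fset {fset set G}}) : T != fset0 ->
  (forall A, A \in T -> nerve (@Hfi G) A) ->
  (forall A B, A \in T -> B \in T -> (A `<=` B)%fset \/ (B `<=` A)%fset) ->
  chains (@Pfi G) (fun C D : set G => C `<=` D) [fset common_part A | A in T]%fset.
Proof.
move=> T0 TL nest.
have anti A B : (A `<=` B)%fset -> common_part B `<=` common_part A.
  by move=> /fsubsetP AB x Bx C /AB; exact: Bx.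
split.
- have /fset0Pn[A AT] := T0; apply/fset0Pn; exists (common_part A).
  by apply/imfsetP; exists A.
- by move=> _ /imfsetP[A /= AT ->]; exact/nerve_bigcap/TL.
- move=> _ _ /imfsetP[A /= AT ->] /imfsetP[B /= BT ->].
  by have [/anti|/anti] := nest A B AT BT; [right|left].
Qed.

Theorem contractible_coset_complexes (R : realType) : has_infinite_dihedral_image G ->
  contractible R (realization R (nerve_complex (@Hfi G))) /\
  contractible R (realization R (order_complex_Pfi G)).
Proof.
move=> [f [fM [t [T [T0 ft]]]]].
have [|||h [x [hf h0 h1]]] := @exists_cone_contraction R _ (nerve_complex (@Hfi G))
    (rank t T) (apex f T).
- move=> n; split.
  + by apply/fset0Pn; exists (apex f T n); rewrite inE.
  + by move=> C /=; rewrite inE => /eqP ->; exact: (apex_Pfi fM T0 ft).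
  + exists 1%g => C; rewrite inE => /eqP ->.
    exact: (subgroup1 (congruence_is_subgroup fM _)).
- by move=> n; exact: (rank_apex fM ft).
- by move=> s n; exact: (nerve_cone fM T0 ft).
split; first exact: finitary_contractible hf h0 h1.
apply: (@retract_contractible _ _ _ (nerve_complex (@Hfi G)) common_part
  _ _ _ h x) => //.
- exact: chain_nerve.
- exact: common_part_nested.
- exact: common_part_chain.
Qed.

End CosetComplexes.

Theorem corollary6p5 (R : realType) (G : groupType)
  (hG :
    (exists (n : nat) (Gs : 'I_n -> groupType),
       [/\ (1 <= n)%N, forall i, listed_group (Gs i) &
           isomorphic G (free_product Gs) \/ is_direct_product Gs G]) \/
    (exists G1 G2 : groupType,
       [/\ listed_group G1, listed_group G2 & is_semidirect_product G1 G2 G]) \/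
    (exists G1 : groupType,
       listed_group G1 /\ is_finite_index_subgroup G1 G)) :
  contractible R (realization R (nerve_complex (@Hfi G))) /\
  contractible R (realization R (order_complex_Pfi G)).
Proof.
apply: contractible_coset_complexes.
case: hG => [[n [Gs [n1 lG [iso|prod]]]]|[[G1 [G2 [_ l2 sd]]]|[G1 [l1 fi]]]].
- apply: dihedral_image_iso iso _; apply: dihedral_image_free_product n1 _ => i.
  exact: dihedral_image_listed.
- by apply: dihedral_image_direct_product n1 _ prod => i; exact: dihedral_image_listed.
- exact: dihedral_image_semidirect (dihedral_image_listed l2) sd.
- exact: dihedral_image_finite_index (dihedral_image_listed l1) fi.
Qed.
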